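(* Let $m,n$ be positive integers. Let $A_1, A_2$ be non-trivial nilpotent groups of exponent $m$ generating the same variety, i.e. $\mathrm{var}(A_1)=\mathrm{var}(A_2)$, and let $B_1, B_2$ be non-trivial abelian groups of exponent $n$ generating the same variety, i.e. $\mathrm{var}(B_1)=\mathrm{var}(B_2)$, where any prime divisor $p$ of $n$ also divides $m$. Then the equality $$\mathrm{var}(A_1 \,\mathrm{Wr}\, B_1)=\mathrm{var}(A_2 \,\mathrm{Wr}\, B_2)$$ holds if and only if $B_1(p)\equiv B_2(p)$ for each prime divisor $p$ of $n$.
   Context: $\mathrm{var}(G)$ denotes the variety of groups generated by the group $G$. $A\,\mathrm{Wr}\,B$ denotes the Cartesian (unrestricted) wreath product, i.e. the semidirect product of the base group $A^B$ of all functions $B\to A$ with $B$ acting by translation of the argument (regular wreath product; $A$ is passive, $B$ is active). Exponents are exact: $m$ is the exponent of each $A_i$ and $n$ is the exponent of each $B_i$. For an abelian group $B$ of finite exponent and a prime $p$, $B(p)$ denotes the $p$-primary component of $B$, the subgroup of all elements whose orders are powers of $p$. $C_{q}$ is the cyclic group of order $q$, and for a cardinal $\mathfrak m$, $C_q^{\mathfrak m}$ is the direct product (direct sum, finite support) of $\mathfrak m$ copies of $C_q$. By Prüfer's theorem $B(p)$ is a direct product of finite cyclic $p$-groups; collecting the factors of equal order, $$B(p)=C_{p^{u_1}}^{\mathfrak m_{p^{u_1}}}\times\cdots\times C_{p^{u_r}}^{\mathfrak m_{p^{u_r}}},\qquad u_1>\cdots>u_r\ge 1,$$ with non-zero cardinals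 $\mathfrak m_{p^{u_i}}$; the $u_i$ and $\mathfrak m_{p^{u_i}}$ are invariants determining $B(p)$ up to isomorphism. Equivalence $\equiv$: let $B_1(p)=C_{p^{u_1}}^{\mathfrak m_{p^{u_1}}}\times\cdots\times C_{p^{u_r}}^{\mathfrak m_{p^{u_r}}}$ and $B_2(p)=C_{p^{v_1}}^{\mathfrak m_{p^{v_1}}}\times\cdots\times C_{p^{v_s}}^{\mathfrak m_{p^{v_s}}}$ be such decompositions (the $\mathfrak m_{p^{u_i}}$ being the multiplicities for $B_1(p)$ and the $\mathfrak m_{p^{v_i}}$ the multiplicities for $B_2(p)$). Then: (1) if $B_1(p),B_2(p)$ are both finite, $B_1(p)\equiv B_2(p)$ if and only if they are isomorphic, i.e. $r=s$ and $u_i=v_i$, $\mathfrak m_{p^{u_i}}=\mathfrak m_{p^{v_i}}$ for all $i=1,\ldots,r$; (2) if $B_1(p),B_2(p)$ are both infinite, $B_1(p)\equiv B_2(p)$ if and only if there is a $k$ such that (i) $u_i=v_i$ and $\mathfrak m_{p^{u_i}}=\mathfrak m_{p^{v_i}}$ for each $i=1,\ldots,k-1$; and (ii) $C_{p^{u_k}}^{\mathfrak m_{p^{u_k}}}$ is the first infinite factor in the decomposition of $B_1(p)$, $C_{p^{v_k}}^{\mathfrak m_{p^{v_k}}}$ is the first infinite factor in the decomposition of $B_2(p)$, and $u_k=v_k$ (the infinite cardinals $\mathfrak m_{p^{u_k}}$ and $\mathfrak m_{p^{v_k}}$ need not be equal); (3) in all other cases $B_1(p)$ and $B_2(p)$ are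 not equivalent. *)

(* Defs.v *)
From HB Require Import structures.
From mathcomp Require Import all_boot.
From mathcomp Require Import zmodp.
From mathcomp Require Import boolp classical_sets functions cardinality.

Set Implicit Arguments.
Unset Strict Implicit.
Unset Printing Implicit Defensive.

Local Open Scope classical_set_scope.
Local Open Scope card_scope.
Local Open Scope group_scope.

Inductive word :=
  | Var of nat
  | One
  | Mul of word & word
  | Inv of word.

Fixpoint eval (G : groupType) (e : nat -> G) (w : word) : G :=
  match w with
  | Var i => e i
  | One => 1
  | Mul w1 w2 => eval e w1 * eval e w2
  | Inv w1 => (eval e w1)^-1
  end.

(* The word w stands for the law w = 1. *)
Definition satisfies (G : groupType) (w : word) : Prop :=
  forall e : nat -> G, eval e w = 1.

Definition variety (V : groupType -> Prop) : Prop :=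
  exists L : set word,
    forall G : groupType, V G <-> (forall w, L w -> satisfies G w).

Definition var (G : groupType) : groupType -> Prop :=
  fun H => forall V, variety V -> V G -> V H.

Definition same_var (G1 G2 : groupType) : Prop :=
  forall H : groupType, var G1 H <-> var G2 H.

Definition nontrivial (G : groupType) : Prop := exists x : G, x <> 1.

Definition abelian_group (G : groupType) : Prop :=
  forall x y : G, x * y = y * x.

Definition has_exponent (G : groupType) (n : nat) : Prop :=
  [/\ (0 < n)%N, forall x : G, x ^+ n = 1
    & forall k, (0 < k)%N -> (forall x : G, x ^+ k = 1) -> (n <= k)%N].

Definition subgroup (G : groupType) (H : set G) : Prop :=
  H 1 /\ forall x y, H x -> H y -> H (x / y).

Definition generated (G : groupType) (X : set G) : set G :=
  smallest (@subgroup G) X.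

Fixpoint lower_central (G : groupType) (c : nat) : set G :=
  if c is c'.+1 then
    generated [set [~ x, y] | x in lower_central c' & y in [set: G]]
  else [set: G].
Arguments lower_central : clear implicits.

Definition nilpotent_group (G : groupType) : Prop :=
  exists c, lower_central G c = [set 1].

(* The pair (b, f) stands for the product b f of the active element b and the
   base element f, with f ^ b = fun x => f (x b^-1). *)
Definition wreath (A B : groupType) : Type := (B * (B -> A))%type.

Section Wreath.
Variables A B : groupType.

HB.instance Definition _ := Choice.on (wreath A B).

Definition wr_mul (g h : wreath A B) : wreath A B :=
  (g.1 * h.1, fun x => g.2 (x * h.1^-1) * h.2 x).

Definition wr_one : wreath A B := (1, fun=> 1).

Definition wr_inv (g : wreath A B) : wreath A B :=
  (g.1^-1, fun x => (g.2 (x * g.1))^-1).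

Fact wr_mulA : associative wr_mul.
Proof.
move=> [a f] [b g] [c h]; rewrite /wr_mul /= mulgA; congr pair.
by apply: funext => x; rewrite invgM !mulgA.
Qed.

Fact wr_mul1 : left_id wr_one wr_mul.
Proof.
move=> [a f]; rewrite /wr_mul /= mul1g; congr pair.
by apply: funext => x; rewrite mul1g.
Qed.

Fact wr_mulr1 : right_id wr_one wr_mul.
Proof.
move=> [a f]; rewrite /wr_mul /= mulg1; congr pair.
by apply: funext => x; rewrite invg1 !mulg1.
Qed.

Fact wr_mulV : left_inverse wr_one wr_inv wr_mul.
Proof.
move=> [a f]; rewrite /wr_mul /wr_one /= mulVg; congr pair.
by apply: funext => x; rewrite mulgVK mulVg.
Qed.

Fact wr_mulrV : right_inverse wr_one wr_inv wr_mul.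
Proof.
move=> [a f]; rewrite /wr_mul /wr_one /= mulgV; congr pair.
by apply: funext => x; rewrite invgK mulgV.
Qed.

HB.instance Definition _ := isGroup.Build (wreath A B)
  wr_mulA wr_mul1 wr_mulr1 wr_mulV wr_mulrV.

End Wreath.

Record dirprod (I : Type) (G : I -> groupType) := DirProd {
  dp_fun :> forall i, G i;
  dp_finite : `[< finite_set [set i | dp_fun i <> 1] >]
}.

Section DirProd.
Variables (I : Type) (G : I -> groupType).
Implicit Types f g : dirprod G.

HB.instance Definition _ := [isSub for @dp_fun I G].
HB.instance Definition _ := [Choice of dirprod G by <:].

Fact dp_mul_subproof f g :
  `[< finite_set [set i | f i * g i <> 1] >].
Proof.
apply/asboolP; have /asboolP finf := dp_finite f.
have /asboolP fing := dp_finite g.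
apply: sub_finite_set (_ : _ `<=` [set i | f i <> 1] `|` [set i | g i <> 1]) _.
  move=> i /= fgi; have [fi|fi] := EM (f i = 1); last by left.
  by right=> gi; apply: fgi; rewrite fi gi mulg1.
by rewrite finite_setU.
Qed.

Fact dp_one_subproof : `[< finite_set [set i | (1 : G i) <> 1] >].
Proof.
by apply/asboolP; apply: sub_finite_set (finite_set0 I) => i /=.
Qed.

Fact dp_inv_subproof f : `[< finite_set [set i | (f i)^-1 <> 1] >].
Proof.
apply/asboolP; have /asboolP := dp_finite f.
by apply: sub_finite_set => i /= fi fi1; apply: fi; rewrite fi1 invg1.
Qed.

Definition dp_mul f g : dirprod G := DirProd (dp_mul_subproof f g).
Definition dp_one : dirprod G := DirProd dp_one_subproof.
Definition dp_inv f : dirprod G := DirProd (dp_inv_subproof f).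

Fact dp_mulA : associative dp_mul.
Proof.
by move=> f g h; apply: val_inj; apply: functional_extensionality_dep => i /=;
  rewrite mulgA.
Qed.

Fact dp_mul1 : left_id dp_one dp_mul.
Proof.
by move=> f; apply: val_inj; apply: functional_extensionality_dep => i /=;
  rewrite mul1g.
Qed.

Fact dp_mulr1 : right_id dp_one dp_mul.
Proof.
by move=> f; apply: val_inj; apply: functional_extensionality_dep => i /=;
  rewrite mulg1.
Qed.

Fact dp_mulV : left_inverse dp_one dp_inv dp_mul.
Proof.
by move=> f; apply: val_inj; apply: functional_extensionality_dep => i /=;
  rewrite mulVg.
Qed.

Fact dp_mulrV : right_inverse dp_one dp_inv dp_mul.
Proof.
by move=> f; apply: val_inj; apply: functional_extensionality_dep => i /=;
  rewrite mulgV.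
Qed.

HB.instance Definition _ := isGroup.Build (dirprod G)
  dp_mulA dp_mul1 dp_mulr1 dp_mulV dp_mulrV.

End DirProd.

(* The additive group of residues mod q; of order q for q > 0. *)
Definition cyclic (q : nat) : groupType := 'I_q.-1.+1.

(* The cardinal exponent is given as that of a type M. *)
Definition cyclic_pow (q : nat) (M : Type) : groupType :=
  dirprod (fun _ : M => cyclic q).

Definition set_isog (G H : groupType) (X : set G) (Y : set H) : Prop :=
  exists f : G -> H,
    set_bij X Y f /\ forall x y, X x -> X y -> f (x * y) = f x * f y.

Definition primary (B : groupType) (p : nat) : set B :=
  [set x | exists k : nat, x ^+ (p ^ k) = 1].
Arguments primary : clear implicits.

Definition primary_decomposition (B : groupType) (p r : nat)
    (u : nat -> nat) (M : nat -> Type) : Prop :=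
  [/\ forall i j, (i < j < r)%N -> (u j < u i)%N,
      forall i, (i < r)%N -> (1 <= u i)%N,
      forall i, (i < r)%N -> [set: M i] !=set0
    & set_isog (primary B p)
        [set: dirprod (fun i : 'I_r => cyclic_pow (p ^ u i) (M i))]].

Definition first_infinite_factor (p : nat) (u : nat -> nat) (M : nat -> Type)
    (k : nat) : Prop :=
  infinite_set [set: cyclic_pow (p ^ u k) (M k)] /\
  forall i, (i < k)%N -> finite_set [set: cyclic_pow (p ^ u i) (M i)].

(* Factors are numbered from 0, so that the k below is the usual k - 1. By
   Pruefer's theorem decompositions exist for abelian groups of finite
   exponent, and they are unique up to the cardinalities of the M i. *)
Definition primary_equiv (p : nat) (B1 B2 : groupType) : Prop :=
  [/\ finite_set (primary B1 p), finite_set (primary B2 p)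
    & set_isog (primary B1 p) (primary B2 p)] \/
  [/\ infinite_set (primary B1 p), infinite_set (primary B2 p)
    & exists (r s : nat) (u v : nat -> nat) (M N : nat -> Type),
      [/\ primary_decomposition B1 p r u M,
          primary_decomposition B2 p s v N
        & exists k : nat,
          [/\ (k < r)%N /\ (k < s)%N,
              forall i, (i < k)%N -> u i = v i /\ [set: M i] #= [set: N i],
              first_infinite_factor p u M k,
              first_infinite_factor p v N k
            & u k = v k]]].

(* Main.v *)
From Stdlib Require Eqdep_dec.
From HB Require Import structures.
From mathcomp Require Import all_boot all_algebra.
From mathcomp Require Import boolp classical_sets functions cardinality.
Require Import Defs.

Set Implicit Arguments.
Unset Strict Implicit.
Unset Printing Implicit Defensive.

Local Open Scope classical_set_scope.
Local Open Scope card_scope.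
Local Open Scope group_scope.

(** A word is a law of [A Wr B] exactly when, for all values of its variables
    in [B], it is trivial in [B] and the coordinates of its base part, which
    are words again, are laws of [A].  So the variety depends only on the laws
    of [A] and on the finitely generated subgroups of [B]
    ([wreath_satisfies]).  If the primary components of [B1] and [B2] are
    equivalent, every finitely generated subgroup of one of them embeds into
    the other: the factors of [B1(p)] from the first infinite one on are all
    subgroups of the infinitely many equal factors of [B2(p)]
    ([local_embedding]).

    Conversely, the passive groups may be taken to be the same group [A], and
    every prime [p] dividing [n] divides the exponent of [A].  As [A] is
    nilpotent, some word that is not a law of [A] takes central values of
    order dividing [p] only ([central_word_cases]).  Evaluated at commutators,
    this word takes values in the functions from [B] to an elementary abelian
    [p]-group, on which [B] acts by translations and the commutator with [y]
    is the difference operator [T_y - 1] over the field with [p] elements.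
    Let [B(p)] be a direct sum of groups [<g_i>] of order [p^(u_i)], and let
    [y_1, y_2, ...] run over [p^j B(p)].  In characteristic [p] the operator
    [T_g - 1] is nilpotent of index the order of [g] if that order is a power
    of [p]; therefore products of [T_(y_l) - 1] vanish as soon as they have
    more than

      sum over the [i] with [u_i > j] of [p^(u_i - j) - 1]

    factors ([diffs_eq0]), while a product of exactly that length does not
    vanish on functions supported at one point ([diffs_delta_neq0]).  Hence
    a law tells [A Wr B1] from [A Wr B2] if this number differs for [B1] and
    [B2] ([wreath_law_separates]).  For [j = u_1 - 1, u_1 - 2, ...] in turn, it
    determines the number of cyclic summands of each order down to the first
    order for which it is infinite ([level_card_le]): this is the equivalence
    class of [B(p)].  That [B(p)] is a direct sum of cyclic groups is
    Pruefer's theorem, proved here by choosing bases of the layers of its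
    socle ([exists_basis]). *)

(** * Words, laws and substitutions *)

Lemma eval_morph (G H : groupType) (f : G -> H) (e : nat -> G) w :
  (forall x y, f (x * y) = f x * f y) -> f (eval e w) = eval (f \o e) w.
Proof.
move=> fM; have f1 : f 1 = 1.
  by apply: (@mulgI _ (f 1)); rewrite -fM !mulg1.
elim: w => [i||w1 IH1 w2 IH2|w IH] //=; first by rewrite fM IH1 IH2.
by apply: (@mulgI _ (f (eval e w))); rewrite -fM mulgV f1 IH mulgV.
Qed.

Fixpoint var_bound (w : word) : nat :=
  match w with
  | Var i => i.+1
  | One => 0
  | Mul w1 w2 => maxn (var_bound w1) (var_bound w2)
  | Inv w => var_bound w
  end.

Lemma eq_eval (G : groupType) (e e' : nat -> G) w :
  (forall i, (i < var_bound w)%N -> e i = e' i) -> eval e w = eval e' w.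
Proof.
elim: w => [i||w1 IH1 w2 IH2|w IH] //= ee'; first exact: ee'.
  by rewrite IH1 ?IH2 // => i iw; apply: ee'; rewrite leq_max iw ?orbT.
by rewrite IH.
Qed.

Fixpoint subst (s : nat -> word) (w : word) : word :=
  match w with
  | Var i => s i
  | One => One
  | Mul w1 w2 => Mul (subst s w1) (subst s w2)
  | Inv w => Inv (subst s w)
  end.

Lemma eval_subst (G : groupType) (e : nat -> G) s w :
  eval e (subst s w) = eval (fun i => eval e (s i)) w.
Proof. by elim: w => [i||w1 IH1 w2 IH2|w IH] //=; rewrite ?IH1 ?IH2 ?IH. Qed.

Fixpoint wpow (w : word) (k : nat) : word :=
  if k is k'.+1 then Mul w (wpow w k') else One.

Lemma eval_wpow (G : groupType) (e : nat -> G) w k :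
  eval e (wpow w k) = eval e w ^+ k.
Proof. by elim: k => //= k ->; rewrite expgS. Qed.

Definition wcomm (w1 w2 : word) : word :=
  Mul (Inv w1) (Mul (Inv w2) (Mul w1 w2)).

Lemma eval_wcomm (G : groupType) (e : nat -> G) w1 w2 :
  eval e (wcomm w1 w2) = [~ eval e w1, eval e w2].
Proof. by []. Qed.

Lemma eval_One (G : groupType) (w : word) : eval (fun=> 1 : G) w = 1.
Proof.
elim: w => [i||w1 IH1 w2 IH2|w IH] //=; rewrite ?IH1 ?IH2 ?IH ?mulg1 //.
by rewrite invg1.
Qed.

Lemma same_varP (G1 G2 : groupType) :
  same_var G1 G2 <-> (forall w, satisfies G1 w <-> satisfies G2 w).
Proof.
have varP (G H : groupType) :
    var G H <-> (forall w, satisfies G w -> satisfies H w).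
  split=> [GH|GH V [L VL] VG].
    pose V (K : groupType) := forall w, satisfies G w -> satisfies K w.
    have VV : variety V by exists [set w | satisfies G w].
    exact: (GH V VV).
  by apply/VL => w Lw; apply: GH; apply: (VL G).1.
split=> [GG w|GG H].
  by split; apply: (varP _ _).1; apply/GG => V.
by split=> /varP GH; apply/varP => w /GG; apply: GH.
Qed.

(** * Laws of wreath products *)

Section Coordinates.
Variable B : groupType.
Variables (b : nat -> B) (code : nat -> B -> nat).

(** The value of [w] on elements [b_i f_i] of a wreath product has a base part
    whose value at [x] is a word in the values [f_i y].  This is that word,
    [f_i y] being the variable number [code i y]. *)
Fixpoint coord (w : word) (x : B) : word :=
  match w with
  | Var i => Var (code i x)
  | One => One
  | Mul w1 w2 => Mul (coord w1 (x * (eval b w2)^-1)) (coord w2 x)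
  | Inv w => Inv (coord w (x * eval b w))
  end.

Fixpoint coord_args (w : word) (x : B) : seq (nat * B) :=
  match w with
  | Var i => [:: (i, x)]
  | One => [::]
  | Mul w1 w2 => coord_args w1 (x * (eval b w2)^-1) ++ coord_args w2 x
  | Inv w => coord_args w (x * eval b w)
  end.

End Coordinates.

Lemma eval_wreath1 (A B : groupType) (e : nat -> wreath A B) w :
  (eval e w).1 = eval (fun i => (e i).1) w.
Proof. by elim: w => [i||w1 IH1 w2 IH2|w IH] //=; rewrite ?IH1 ?IH2 ?IH. Qed.

Lemma eval_wreath2 (A B : groupType) (e : nat -> wreath A B) code
    (a : nat -> A) w x :
  (forall i y, (i, y) \in coord_args (fun i => (e i).1) w x ->
     a (code i y) = (e i).2 y) ->
  (eval e w).2 x = eval a (coord (fun i => (e i).1) code w x).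
Proof.
elim: w x => [i||w1 IH1 w2 IH2|w IH] x //= ax.
- by rewrite ax ?inE.
- rewrite -IH1 => [|i y iy]; last by apply: ax; rewrite mem_cat iy.
  rewrite -IH2 => [|i y iy]; last by apply: ax; rewrite mem_cat iy orbT.
  by rewrite -eval_wreath1.
- by rewrite -IH // -eval_wreath1.
Qed.

(** The coordinate words of [w] at [b : nat -> B1] involve the elements of [B1]
    through the relations between the [b i] only.  So they are coordinate
    words at any [b' : nat -> B2] with the same relations. *)
Lemma wreath_satisfies (A1 A2 B1 B2 : groupType) :
  (forall w, satisfies A2 w -> satisfies A1 w) ->
  (forall N (b : nat -> B1), (forall i, (N <= i)%N -> b i = 1) ->
     exists b' : nat -> B2, forall w, eval b w = 1 <-> eval b' w = 1) ->
  forall w, satisfies (wreath A2 B2) w -> satisfies (wreath A1 B1) w.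
Proof.
move=> A21 B12 w lw e0.
pose e i := if (i < var_bound w)%N then e0 i else 1.
have -> : eval e0 w = eval e w by apply: eq_eval => i iw; rewrite /e iw.
pose b i := (e i).1.
have [|b' bb'] := B12 (var_bound w) b.
  by move=> i; rewrite /b /e ltnNge => ->.
have evb (c : nat -> B2) : eval c w = 1.
  have := lw (fun i => (c i, fun=> 1)).
  by move/(congr1 fst); rewrite eval_wreath1.
rewrite [eval e w]surjective_pairing eval_wreath1 -/b.
have -> : eval b w = 1 by apply/bb'.
congr pair; apply: funext => x.
(* a code separating the finitely many arguments that occur *)
pose s := coord_args b w x.
pose code i y := index (i, y) s.
pose a k := (e (nth (0%N, 1) s k).1).2 (nth (0%N, 1) s k).2.
rewrite (@eval_wreath2 _ _ _ code a) => [|i y iy]; last first.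
  by rewrite /a /code nth_index.
(* the same word is a coordinate word at 1 in the other wreath product *)
have [|rep repP] := @choice B2 word
    (fun y v => forall u, eval b' u = y -> eval b' v = y).
  move=> y; have [[u uy]|ny] := EM (exists u, eval b' u = y).
    by exists u.
  by exists One => u uy; case: ny; exists u.
pose code' i (y : B2) := code i (x * eval b (rep y)).
have relE u v : eval b' u = eval b' v -> eval b u = eval b v.
  move=> uv; apply: divg1_eq; apply/(bb' (Mul u (Inv v))) => /=.
  by rewrite uv mulgV.
have cE v u : coord b' code' v (eval b' u) = coord b code v (x * eval b u).
  elim: v u => [i||v1 IH1 v2 IH2|v IH] u //=.
  - congr Var; rewrite /code' /=; congr (code i (x * _)).
    by apply: relE; apply: (repP _ u).
  - by rewrite IH2 (IH1 (Mul u (Inv v2))) /= mulgA.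
  - by rewrite (IH (Mul u v)) /= mulgA.
have := cE w One; rewrite /= mulg1 => <-.
apply: A21 => a'.
have := lw (fun i => (b' i, fun y => a' (code' i y))).
move/(congr1 (fun g => g.2 1)).
by rewrite (@eval_wreath2 _ _ _ code' a').
Qed.

(** * Central words of prime order in nilpotent groups *)

(** Commutators with ever new variables reach arbitrarily deep terms of the
    lower central series, so the last of them that is not a law exists. *)
Lemma commute_ext (A : groupType) (d : nat) (P : word -> Prop) (w0 : word) :
  nilpotent_group A -> P w0 -> ~ satisfies A w0 ->
  (forall w, P w -> P (wcomm w (wpow (Var (var_bound w)) d))) ->
  exists w, [/\ P w, ~ satisfies A w
    & forall e x, commute (eval e w : A) (x ^+ d)].
Proof.
move=> [c Ac] Pw0 nw0 PS.
pose ext k := iter k (fun w => wcomm w (wpow (Var (var_bound w)) d)) w0.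
have Pext k : P (ext k) by elim: k => //= k; apply: PS.
have ext_lower k (e : nat -> A) : lower_central A k (eval e (ext k)).
  elim: k => [|k IH] //; apply: sub_gen_smallest.
  by exists (eval e (ext k)) => //; exists (eval e (wpow (Var (var_bound (ext k))) d)).
have ex_law : exists k, `[< satisfies A (ext k) >].
  by exists c; apply/asboolP => e; have := ext_lower c e; rewrite Ac.
case: (ex_minnP ex_law) => -[/asboolP //|k] /asboolP lawk kmin.
exists (ext k); split=> // [/asboolP /kmin|e x]; first by rewrite ltnn.
apply/commgP/eqP.
pose e' i := if (i < var_bound (ext k))%N then e i else x.
have := lawk e'; rewrite /= -/(ext k) => <-.
have -> : eval e (ext k) = eval e' (ext k).
  by apply: eq_eval => i ik; rewrite /e' ik.
by rewrite eval_wpow /= /e' ltnn.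
Qed.

(** The centre of the centralizer of all [d]-th powers: an abelian normal
    subgroup containing every iterated commutator of [d]-th powers that
    itself commutes with all [d]-th powers. *)
Definition power_centre (A : groupType) (d : nat) (z : A) : Prop :=
  (forall x, commute z (x ^+ d)) /\
  (forall y, (forall x, commute y (x ^+ d)) -> commute y z).

Lemma commute_conj (A : groupType) (x y z : A) :
  commute x y -> commute (x ^ z) (y ^ z).
Proof. by rewrite /commute -!conjMg => ->. Qed.

Lemma commuteR (A : groupType) (x y z : A) :
  commute x y -> commute x z -> commute x [~ y, z].
Proof.
move=> xy xz; rewrite /commg /conjg.
by do !apply: commuteM => //; apply: commuteV.
Qed.

Lemma power_centre_comm (A : groupType) d p (z x : A) :
  power_centre d z -> z ^+ p = 1 ->
  power_centre d [~ z, x] /\ [~ z, x] ^+ p = 1.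
Proof.
move=> [zd zc] zp1.
have zxd y : commute (z ^ x) (y ^+ d).
  by rewrite -(conjgKV x y) -conjXg; apply: commute_conj.
have zxc y : (forall x, commute y (x ^+ d)) -> commute y (z ^ x).
  move=> yd; rewrite -(conjgKV x y); apply/commute_conj/zc => t.
  by rewrite -(conjgK x t) -conjXg; apply: commute_conj.
rewrite commgEl; split; [split=> y|].
- by apply: commute_sym; apply: commuteM; [apply: commuteV|]; apply: commute_sym.
- by move=> yd; apply: commuteM; [apply/commuteV/zc|apply: zxc].
- rewrite expgMn; last by apply/commute_sym/commuteV; apply: zc.
  by rewrite expVgn zp1 -conjXg zp1 conj1g invg1 mulg1.
Qed.

(** If [c = [~ u, x]] commutes with [x], then [x ^ u = x c^-1] gives
    [x^k ^ u = x^k c^-k]. *)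
Lemma order_commg (A : groupType) (u x : A) k :
  commute [~ u, x] x -> x ^+ k = 1 -> [~ u, x] ^+ k = 1.
Proof.
move=> ux xk; have uxE : [~ u, x] = x^-1 ^ u * x by rewrite commgEr.
have xuE : x ^ u = x * [~ u, x]^-1.
  by rewrite uxE invgM conjVg invgK mulVKg.
have := congr1 (fun t => t ^+ k) xuE.
rewrite -conjXg xk conj1g expgMn ?xk ?mul1g; last first.
  by apply: commuteV; apply: commute_sym.
by rewrite expVgn => /esym/eqP; rewrite invg_eq1 => /eqP.
Qed.

(** For [m = p^a m'] with [m'] prime to [p], a longest nontrivial commutator of
    [m']-th powers has values of [p]-power order in an abelian normal
    subgroup; a suitable power of it has values of order [p], and commutators
    of the latter with new variables keep this property until they become
    central. *)
Lemma central_word (A : groupType) m p :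
  nilpotent_group A -> has_exponent A m -> prime p -> (p %| m)%N ->
  exists w, [/\ ~ satisfies A w, forall (e : nat -> A) x, commute (eval e w) x
    & forall e : nat -> A, eval e w ^+ p = 1].
Proof.
move=> nilA [m_gt0 Am Amin] p_pr p_m.
pose m' := (m`_p^')%N; pose q := (m`_p)%N.
have mE : m = (m' * q)%N by rewrite mulnC partnC.
have q_gt1 : (1 < q)%N.
  rewrite /q p_part -[X in (X < _)%N](expn0 p) ltn_exp2l ?prime_gt1 //.
  by rewrite logn_gt0 mem_primes p_pr m_gt0.
have m'_gt0 : (0 < m')%N by rewrite part_gt0.
pose P w := (forall e (y : A), (forall x, commute y (x ^+ m')) ->
    commute y (eval e w)) /\
  ((forall e : nat -> A, eval e w ^+ q = 1) \/
   (exists w1 i, w = wcomm w1 (wpow (Var i) m'))).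
have [||| u [[uc uq] nu ucm]] := @commute_ext A m' P (wpow (Var 0) m') nilA.
- split=> [e y yc|]; first by rewrite eval_wpow; apply: yc.
  by left=> e; rewrite eval_wpow -expgnA -mE Am.
- move=> law0; have /Amin : forall x : A, x ^+ m' = 1.
    by move=> x; have := law0 (fun=> x); rewrite eval_wpow.
  by move=> /(_ m'_gt0); rewrite mE leqNgt ltn_Pmulr.
- move=> w [wc _]; split; last by right; exists w, (var_bound w).
  move=> e y yc; rewrite eval_wcomm; apply: commuteR; first exact: wc.
  by rewrite eval_wpow; apply: yc.
have {}uq (e : nat -> A) : eval e u ^+ q = 1.
  case: uq => [//|[w1 [i uE]]].
  have := ucm e (e i); rewrite uE eval_wcomm eval_wpow /= => cux.
  by apply: order_commg => //; rewrite -expgnA -mE Am.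
have ucentre (e : nat -> A) : power_centre m' (eval e u).
  by split=> [x|y]; [apply: ucm|apply: uc].
have ex_k : exists k, `[< satisfies A (wpow u (p ^ k)) >].
  by exists (logn p m); apply/asboolP => e; rewrite eval_wpow -p_part; apply: uq.
case: (ex_minnP ex_k) => -[|k] /asboolP lawk kmin.
  by case: nu => e; have := lawk e; rewrite /= mulg1.
have nk : ~ satisfies A (wpow u (p ^ k)).
  by move=> /asboolP lk; have := kmin _ lk; rewrite ltnn.
pose Q w := forall e : nat -> A,
  power_centre m' (eval e w) /\ eval e w ^+ p = 1.
have pcX (z : A) j : power_centre m' z -> power_centre m' (z ^+ j).
  move=> [zc zz]; split=> [x|y yc]; last by apply: commuteX; apply: zz.
  by apply: commute_sym; apply: commuteX; apply: commute_sym.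
have [||| v [Qv nv vc]] := @commute_ext A 1 Q (wpow u (p ^ k)) nilA.
- move=> e; rewrite eval_wpow; split; first exact: pcX.
  by rewrite -expgnA -expnSr -(eval_wpow e); apply: lawk.
- exact: nk.
- by move=> w Qw e; rewrite eval_wcomm; have [? ?] := Qw e; apply: power_centre_comm.
by exists v; split=> // e; have [_ vp] := Qv e; exact: vp.
Qed.

(** A central word of order [p] in a least number of variables either depends
    on two variables, and is trivial as soon as one of them is, or on one
    only.  In the latter case it induces a homomorphism, unless its deviation
    from being one is a word of the former kind. *)
Lemma central_word_cases (A : groupType) m p :
  nilpotent_group A -> has_exponent A m -> prime p -> (p %| m)%N ->
  exists w, [/\ ~ satisfies A w, forall (e : nat -> A) x, commute (eval e w) x,
    forall e : nat -> A, eval e w ^+ p = 1 &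
    (exists i j, i <> j /\
       forall e : nat -> A, e i = 1 \/ e j = 1 -> eval e w = 1) \/
    ((forall x y : A,
       eval (fun=> x * y) w = eval (fun=> x) w * eval (fun=> y) w) /\
     exists i, forall e : nat -> A, eval e w = eval (fun=> e i) w)].
Proof.
move=> nilA expA p_pr p_m.
have [v [nv vc vp]] := central_word nilA expA p_pr p_m.
pose r (s : seq nat) := subst (fun i => if i \in s then Var i else One) v.
have rE s (e : nat -> A) :
    eval e (r s) = eval (fun i => if i \in s then e i else 1) v.
  by rewrite eval_subst; congr eval; apply: funext => i; case: ifP.
have ex_k : exists k, `[< exists2 s, size s = k & ~ satisfies A (r s) >].
  exists (var_bound v); apply/asboolP; exists (iota 0 (var_bound v)).
    by rewrite size_iota.
  move=> lawr; apply: nv => e; rewrite -(lawr e) rE.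
  by apply: eq_eval => i iv; rewrite mem_iota iv.
case: (ex_minnP ex_k) => k /asboolP [s sk ns] kmin.
have mins t : (size t < size s)%N -> satisfies A (r t).
  move=> ts; apply: contrapT => nt; move: ts; rewrite ltnNge sk kmin //.
  by apply/asboolP; exists t.
have rc e x : commute (eval e (r s) : A) x by rewrite rE.
have rp e : (eval e (r s) : A) ^+ p = 1 by rewrite rE.
have kill i : i \in s -> forall e : nat -> A, e i = 1 -> eval e (r s) = 1.
  move=> i_s e ei; rewrite -(mins [seq j <- s | j != i] _ e); last first.
    rewrite size_filter -(count_predC (pred1 i)) -[X in (X < _)%N]add0n.
    by rewrite ltn_add2r -has_count has_pred1.
  rewrite !rE; congr eval; apply: funext => j; rewrite mem_filter.
  by have [->|] := eqVneq j i; rewrite ?i_s.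
case: s sk ns mins rc rp kill => [|i [|j s]] sk ns mins rc rp kill.
- by case: ns => e; rewrite rE eval_One.
- have r1 (e : nat -> A) : eval e (r [:: i]) = eval (fun=> e i) (r [:: i]).
    by rewrite !rE; congr eval; apply: funext => j; rewrite inE; case: eqP => // ->.
  have [hom|nhom] := EM (forall x y : A, eval (fun=> x * y) (r [:: i]) =
      eval (fun=> x) (r [:: i]) * eval (fun=> y) (r [:: i])).
    by exists (r [:: i]); split=> //; right; split=> //; exists i.
  pose rx t := subst (fun=> t) (r [:: i]).
  have rxE (e : nat -> A) t : eval e (rx t) = eval (fun=> eval e t) (r [:: i]).
    by rewrite eval_subst.
  have rx1 : eval (fun=> 1 : A) (r [:: i]) = 1 by rewrite eval_One.
  exists (Mul (Inv (Mul (rx (Var 0)) (rx (Var 1)))) (rx (Mul (Var 0) (Var 1)))).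
  split=> [law2|e x|e|].
  + apply: nhom => x y; have := law2 (fun k => if k == 0%N then x else y).
    rewrite /= !rxE /= => /mulg1_eq; rewrite invgK; exact: esym.
  + rewrite /= !rxE; apply: commute_sym; apply: commuteM; last first.
      by apply: commute_sym; apply: rc.
    by apply: commuteV; apply: commuteM; apply: commute_sym; apply: rc.
  + rewrite /= !rxE expgMn; last by apply: commute_sym; apply: rc.
    by rewrite expVgn expgMn; [rewrite !rp !mulg1 invg1|apply: rc].
  + left; exists 0%N, 1%N; split=> // e.
    by rewrite /= !rxE /= => -[] ->; rewrite ?mulg1 ?mul1g rx1 ?mul1g ?mulg1 mulVg.
- exists (r [:: i, j & s]); split=> //; left; exists i, j; split.
    move=> ij; apply: ns => e; rewrite -(mins (j :: s) _ e) // !rE.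
    by congr eval; apply: funext => t; rewrite ij !inE; case: eqP.
  by move=> e [] ei; [apply: (kill i)|apply: (kill j)]; rewrite ?inE ?eqxx ?orbT.
Qed.

(** * Difference operators *)

Section Differences.
Local Open Scope ring_scope.
Import GRing.Theory.
Variables Z V : zmodType.
Implicit Types (F : Z -> V) (y z : Z) (s : seq Z).

Definition diff y F : Z -> V := fun x => F (x - y) - F x.

Definition diffs s F : Z -> V := foldl (fun G y => diff y G) F s.
Arguments diffs : simpl never.

Lemma diffC y z F : diff y (diff z F) = diff z (diff y F).
Proof.
apply: funext => x; rewrite /diff (addrAC x) !opprB addrACA [RHS]addrACA.
by congr (_ + _); rewrite addrC.
Qed.

Lemma diffs_cons y s F : diffs (y :: s) F = diff y (diffs s F).
Proof. by rewrite /diffs /=; elim: s F => //= z s IH F; rewrite diffC IH. Qed.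

Lemma diffs_cat s1 s2 F : diffs (s1 ++ s2) F = diffs s1 (diffs s2 F).
Proof. by elim: s1 => //= y s1 IH; rewrite !diffs_cons IH. Qed.

Lemma diffs_rcons s y F : diffs (rcons s y) F = diff y (diffs s F).
Proof. by rewrite /diffs foldl_rcons. Qed.

Lemma diffs_nseq k y F : diffs (nseq k y) F = iter k (diff y) F.
Proof. by elim: k => //= k IH; rewrite diffs_cons IH. Qed.

Lemma perm_diffs s1 s2 F : perm_eq s1 s2 -> diffs s1 F = diffs s2 F.
Proof.
elim: s1 s2 => [|y s1 IH] s2; first by rewrite perm_sym => /perm_nilP ->.
move=> s12; have y_s2 : y \in s2 by rewrite -(perm_mem s12) inE eqxx.
have [t1 [t2 s2E]] : exists t1 t2, s2 = t1 ++ y :: t2.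
  by case/splitPr: y_s2 => t1 t2; exists t1, t2.
have := s12; rewrite s2E perm_sym -cat1s perm_catCA /= perm_cons perm_sym.
move=> /IH eq_s; rewrite diffs_cons eq_s !diffs_cat diffs_cons.
by elim: t1 {s2E eq_s} => // z t1 IHt; rewrite !diffs_cons diffC IHt.
Qed.

Lemma diffsD s F G x : diffs s (fun z => F z + G z) x = diffs s F x + diffs s G x.
Proof.
elim: s x => //= y s IH x; rewrite !diffs_cons /diff !IH opprD !addrA.
by congr (_ + _); rewrite -!addrA; congr (_ + _); rewrite addrC.
Qed.

Lemma diffsN s F x : diffs s (fun z => - F z) x = - diffs s F x.
Proof.
by elim: s x => //= y s IH x; rewrite !diffs_cons /diff !IH opprB opprK addrC.
Qed.

(** The binomial formula for the translation [T = 1 + (T - 1)]. *)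
Lemma translate_binomial y n F x :
  F (x - y *+ n) = \sum_(i < n.+1) iter i (diff y) F x *+ 'C(n, i).
Proof.
elim: n x => [|n IH] x.
  by rewrite subr0 big_ord_recl big_ord0 addr0 /= bin0.
have -> : x - y *+ n.+1 = (x - y) - y *+ n by rewrite mulrS opprD addrA.
rewrite IH.
have shift i : iter i (diff y) F (x - y) =
    iter i (diff y) F x + iter i.+1 (diff y) F x.
  by rewrite iterS; move: (iter i _ F) => G; rewrite /diff [RHS]addrC subrK.
under eq_bigr do rewrite shift mulrnDl.
rewrite big_split /= big_ord_recl [X in _ + X]big_ord_recr /=.
rewrite [RHS]big_ord_recl [X in _ = _ + X]big_ord_recr /= !bin0 !binn.
rewrite -!addrA; congr (_ + _); rewrite addrA; congr (_ + _).
by rewrite -big_split /=; apply: eq_bigr => i _; rewrite /bump /= -mulrnDr binS.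
Qed.

Section CharP.
Variable p : nat.
Hypotheses (p_pr : prime p) (Vp : forall v : V, v *+ p = 0).

Lemma iter_diff_prime y F : iter p (diff y) F = diff (y *+ p) F.
Proof.
apply: funext => x; rewrite {2}/diff translate_binomial.
case: p p_pr Vp => // q q_pr Vq.
rewrite big_ord_recl big_ord_recr /= bin0 binn !mulr1n [RHS]addrC addKr.
rewrite big1 ?add0r // => i _; rewrite /bump /= add1n.
have /dvdnP[k ->] : (q.+1 %| 'C(q.+1, i.+1))%N.
  by apply: prime_dvd_bin => //=; rewrite ltnS ltn_ord.
by rewrite mulrnA Vq.
Qed.

(** In characteristic [p] the operator [T - 1], raised to the power [p^d],
    is [T^(p^d) - 1]. *)
Lemma iter_diff_primeX y d F : iter (p ^ d) (diff y) F = diff (y *+ (p ^ d)) F.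
Proof.
elim: d y F => [|d IH] y F; first by rewrite expn0 mulr1n.
rewrite expnSr mulrnA -iter_diff_prime.
have -> : diff (y *+ p ^ d) = iter (p ^ d) (diff y) by apply: funext => G.
by rewrite mulnC iterM.
Qed.

Variables (I : eqType) (g : I -> Z) (d : I -> nat) (gs : seq I).
Hypothesis gd : forall i, i \in gs -> g i *+ (p ^ d i) = 0.

(** By the pigeonhole principle some [g i] occurs [p^(d i)] times in the list. *)
Lemma diffs_gens_eq0 l F x : {subset l <= gs} ->
  (\sum_(i <- gs) (p ^ d i - 1) < size l)%N -> diffs (map g l) F x = 0.
Proof.
move=> l_gs lt_l.
have size_l : (size l <= \sum_(i <- gs) count_mem i l)%N.
  elim: l l_gs {lt_l} => //= a l IH al_gs; rewrite big_split /=.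
  have /IH{}IH : {subset l <= gs} by move=> i il; apply: al_gs; rewrite inE il orbT.
  have a_gs : a \in gs by apply: al_gs; rewrite inE eqxx.
  by rewrite -add1n leq_add // (big_rem a a_gs) /= eqxx.
have [i i_gs /subnKC li] : exists2 i, i \in gs & (p ^ d i <= count_mem i l)%N.
  apply: contrapT => ni; move: lt_l; rewrite ltnNge; case/negP.
  apply: leq_trans size_l _; rewrite !big_seq; apply: leq_sum => i i_gs.
  rewrite leq_subRL ?expn_gt0 ?prime_gt0 // add1n ltnNge.
  by apply/negP => li; apply: ni; exists i.
have /perm_diffs -> : perm_eq (map g l)
    (nseq (p ^ d i) (g i) ++ nseq (count_mem i l - p ^ d i) (g i) ++
     map g (filter (predC1 i) l)).
  rewrite catA -nseqD li -map_nseq -map_cat; apply: perm_map.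
  rewrite -(perm_filterC (pred1 i) l) perm_cat2r.
  by have /all_pred1P -> := filter_all (pred1 i) l; rewrite size_filter.
rewrite diffs_cat diffs_nseq iter_diff_primeX gd //.
by rewrite /diff subr0 subrr.
Qed.

Definition gen_by y := exists2 l, {subset l <= gs} & y = \sum_(i <- l) g i.

(** As [T_(y+z) - 1 = (T_y - 1) T_z + (T_z - 1)], a product of differences may
    be expanded until only those along generators are left, and among too many
    of these some [g i] occurs [p^(d i)] times. *)
Lemma diffs_eq0 s F x : (forall y, y \in s -> gen_by y) ->
  (\sum_(i <- gs) (p ^ d i - 1) < size s)%N -> diffs s F x = 0.
Proof.
move=> s_gen lt_s.
suff claim t l G z : (forall y, y \in t -> gen_by y) -> {subset l <= gs} ->
    (\sum_(i <- gs) (p ^ d i - 1) < size t + size l)%N ->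
    diffs (t ++ map g l) G z = 0.
  by have := claim s [::] F x s_gen; rewrite cats0 addn0; apply.
elim: t l G z => [|y t IH] l G z t_gen l_gs lt_tl; first exact: diffs_gens_eq0.
have [|ly ly_gs yE] := t_gen y; first by rewrite inE eqxx.
have {}t_gen z' : z' \in t -> gen_by z'.
  by move=> z't; apply: t_gen; rewrite inE z't orbT.
rewrite {}yE; elim: ly ly_gs G z => [|i ly IHly] ily_gs G z.
  by rewrite big_nil /= diffs_cons /diff subr0 subrr.
have i_gs : i \in gs by apply: ily_gs; rewrite inE eqxx.
rewrite big_cons.
set y' := \sum_(j <- ly) g j in IHly *.
have -> : diffs (g i + y' :: t ++ map g l) G =
    diffs (t ++ map g l) (fun u => diff (g i) (fun v => G (v - y')) u + diff y' G u).
  rewrite {1}/diffs /= -/(diffs _ _); congr diffs; apply: funext => u.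
  by rewrite /diff opprD [u + _]addrA [RHS]addrA subrK.
rewrite diffsD.
have -> : diffs (t ++ map g l) (diff y' G) z = 0.
  by apply: IHly => j jl; apply: ily_gs; rewrite inE jl orbT.
rewrite addr0 -[LHS]/(diffs (g i :: t ++ map g l) _ z).
have /perm_diffs -> : perm_eq (g i :: t ++ map g l) (t ++ map g (i :: l)).
  by rewrite -cat1s perm_catCA.
apply: IH => //; last by rewrite /= addnS -addSn.
by move=> j; rewrite inE => /predU1P[->|/l_gs].
Qed.

End CharP.

(** The translates of [F] by [g *+ i], [i <= n], have disjoint supports, hence
    cannot cancel; the last one enters [iter n (diff g) F] with coefficient
    [1]. *)
Lemma diff_support (H : set Z) g n F :
  (forall x y, H x -> H y -> H (x - y)) ->
  (forall x, F x <> 0 -> H x) ->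
  (forall c, (0 < c <= n)%N -> ~ H (g *+ c)) ->
  forall k, (k <= n)%N ->
    (forall x, iter k (diff g) F x <> 0 -> exists2 i, (i <= k)%N & H (x - g *+ i)) /\
    (forall x, H x -> iter k (diff g) F (x + g *+ k) = F x).
Proof.
move=> Hsub FH ng; elim=> [|k IH] kn.
  split=> [x|x _]; last by rewrite addr0.
  by move=> Fx; exists 0%N => //; rewrite subr0; apply: FH.
have [supp top] := IH (ltnW kn); split=> [x|x Hx].
  rewrite iterS => Dx.
  have [Fx|/eqP Fx] := eqVneq (iter k (diff g) F x) 0.
    have [|i ik Hi] := supp (x - g).
      by move=> Fxg; apply: Dx; rewrite {1}/diff Fxg Fx subrr.
    by exists i.+1 => //; rewrite mulrS opprD addrA.
  by have [i ik Hi] := supp x Fx; exists i => //; apply: leqW.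
have xgE : x + g *+ k.+1 - g = x + g *+ k by rewrite mulrSr addrA addrK.
rewrite iterS {1}/diff xgE top //.
suff -> : iter k (diff g) F (x + g *+ k.+1) = 0 by rewrite subr0.
apply: contrapT => /supp [i ik Hi]; apply: (ng (k.+1 - i)%N).
  by rewrite subn_gt0 ltnS ik /= (leq_trans (leq_subr _ _)).
have -> : g *+ (k.+1 - i) = x + g *+ k.+1 - g *+ i - x.
  by rewrite mulrnBr ?(leqW ik) // -[x + _ - _]addrA [RHS]addrC addKr.
exact: Hsub.
Qed.

(** Differences along independent elements, taken less often than their orders,
    do not annihilate a function supported at one point.  Here [sp t] stands
    for the subgroup generated by the part [t] of the family already used. *)
Lemma diffs_delta_neq0 (I : eqType) (sp : seq I -> set Z) (g : I -> Z)
    (n : I -> nat) (s : seq I) (a : V) :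
  (forall t, sp t 0) ->
  (forall t x y, sp t x -> sp t y -> sp t (x - y)) ->
  (forall i t x c, sp t x -> sp (i :: t) (x + g i *+ c)) ->
  (forall i t, uniq (i :: t) -> {subset i :: t <= s} ->
     forall c, (0 < c <= n i)%N -> ~ sp t (g i *+ c)) ->
  uniq s -> a <> 0 ->
  exists x, diffs (flatten [seq nseq (n i) (g i) | i <- s])
    (fun z => if z == 0 then a else 0) x <> 0.
Proof.
move=> sp0 spB spS indep uniq_s a0.
suff [] : (exists x, diffs (flatten [seq nseq (n i) (g i) | i <- s])
    (fun z => if z == 0 then a else 0) x <> 0) /\
  (forall x, diffs (flatten [seq nseq (n i) (g i) | i <- s])
    (fun z => if z == 0 then a else 0) x <> 0 -> sp s x) by [].
elim: s uniq_s indep => [|i s IH] uniq_s indep /=.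
  split; first by exists 0; rewrite /diffs /= eqxx.
  by move=> x; rewrite /diffs /=; case: eqP => // ->.
rewrite diffs_cat diffs_nseq; set G := diffs _ _ in IH *.
have [||[x Gx] suppG] := IH; first by case/andP: uniq_s.
  by move=> j t jt jts; apply: indep => // k kt; rewrite inE jts ?orbT.
have [supp top] := diff_support (spB s) suppG
  (indep i s uniq_s (fun _ => id)) (leqnn (n i)).
split; first by exists (x + g i *+ n i); rewrite top //; apply: suppG.
by move=> z /supp [c _ /(spS i _ _ c)]; rewrite subrK.
Qed.

End Differences.

Section PowerDifferences.
Local Open Scope ring_scope.
Import GRing.Theory.
Variables (Z V : zmodType) (I : eqType) (sp : seq I -> set Z) (k : I -> Z).
Variables (p j : nat) (e : I -> nat) (s : seq I).
Hypotheses (p_pr : prime p) (Vp : forall v : V, v *+ p = 0).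
Hypotheses (sp0 : forall t, sp t 0)
  (spB : forall t x y, sp t x -> sp t y -> sp t (x - y))
  (spS : forall i t x c, sp t x -> sp (i :: t) (x + k i *+ c))
  (indep : forall i t, uniq (i :: t) -> {subset i :: t <= s} ->
     forall c, (0 < c < p ^ e i)%N -> ~ sp t (k i *+ c)).
Hypotheses (uniq_s : uniq s) (ltje : forall i, i \in s -> (j < e i)%N).

(** For an independent family [k] of elements of orders [p ^ e i], the
    corresponding product of differences spans the socle of the group algebra
    over the field with [p] elements of the group generated by the
    [k i *+ p ^ j]. *)
Definition max_list : seq Z :=
  flatten [seq nseq (p ^ (e i - j) - 1) (k i *+ p ^ j) | i <- s].

Let delta (a : V) (z : Z) : V := if z == 0 then a else 0.

Let p_gt0 q : (0 < p ^ q)%N. Proof. by rewrite expn_gt0 prime_gt0. Qed.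

Lemma size_max_list : size max_list = (\sum_(i <- s) (p ^ (e i - j) - 1))%N.
Proof.
rewrite size_flatten /shape -map_comp sumnE big_map.
by apply: eq_bigr => i _; rewrite /= size_nseq.
Qed.

Lemma max_list_root y d : coprime p d -> (forall i, i \in s -> k i *+ p ^ e i = 0) ->
  y \in max_list -> exists z, z *+ (d * p ^ j) = y.
Proof.
move=> pd ke /flattenP [l /mapP[i i_s ->]] /nseqP[-> _].
have d_gt0 : (0 < d)%N.
  case: d pd => //; rewrite /coprime gcdn0 => /eqP p1.
  by move: p_pr; rewrite p1.
have [r _] := Bezoutl (p ^ e i) d_gt0.
rewrite gcdnC (eqP (coprimeXl _ pd)) => /dvdnP[q qE].
exists (k i *+ q); rewrite -mulrnA mulnA -qE mulnDl mul1n mulrnDr.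
by rewrite -mulnA mulnCA mulrnA ke // mul0rn addr0.
Qed.

Let block_lt i c : i \in s ->
  (0 < c <= p ^ (e i - j) - 1)%N -> (0 < p ^ j * c < p ^ e i)%N.
Proof.
move=> i_s /andP[c_gt0 c_le]; rewrite muln_gt0 p_gt0 c_gt0 /=.
apply: leq_ltn_trans (_ : p ^ j * (p ^ (e i - j) - 1) < _)%N.
  by rewrite leq_mul2l c_le orbT.
by rewrite mulnBr -expnD subnKC ?(ltnW (ltje i_s)) // muln1 ltn_subrL !p_gt0.
Qed.

Lemma diffs_max_list a : a <> 0 -> exists x, diffs max_list (delta a) x <> 0.
Proof.
move=> a0; rewrite /max_list.
apply: (@diffs_delta_neq0 _ _ _ sp (fun i => k i *+ p ^ j)) => // [i t x c spx|].
  by rewrite -mulrnA; apply: spS.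
move=> i t it its c c_le; rewrite -mulrnA; apply: indep => //.
by apply: block_lt => //; apply: its; rewrite inE eqxx.
Qed.

(** For [j > 0] a difference along a generator itself may be inserted: it is
    only a [p^j]-th part of one along its [p^j]-th multiple. *)
Lemma diffs_max_list_head i0 s' a : s = i0 :: s' -> (0 < j)%N -> a <> 0 ->
  exists x, diffs max_list (diff (k i0) (delta a)) x <> 0.
Proof.
move=> sE j_gt0 a0.
have i0_s : i0 \in s by rewrite sE inE eqxx.
pose g i := if i == i0 then k i0 else k i *+ p ^ j.
pose n i := if i == i0 then (p ^ j * (p ^ (e i0 - j) - 1)).+1
            else (p ^ (e i - j) - 1)%N.
have [|i t it its c c_le|x nx] := @diffs_delta_neq0 _ V _ sp g n s a sp0 spB _ _ uniq_s a0.
- move=> i t x c spx; rewrite /g; case: eqP => [->|_]; first exact: spS.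
  by rewrite -mulrnA; apply: spS.
- have i_s : i \in s by apply: its; rewrite inE eqxx.
  move: c_le; rewrite /n /g; case: eqP => [ii0 /andP[c_gt0 c_le]|_ c_le].
    rewrite -ii0; apply: indep => //; rewrite c_gt0 /= ii0.
    apply: leq_ltn_trans c_le _; rewrite mulnBr -expnD.
    rewrite subnKC ?(ltnW (ltje i0_s)) // muln1 -subSn; last first.
      by rewrite leq_exp2l ?prime_gt1 // (ltnW (ltje i0_s)).
    rewrite ltn_subLR; last by rewrite ltnW // ltnS leq_exp2l ?prime_gt1 // ltnW // ltje.
    by rewrite -[X in (X < _)%N]add1n ltn_add2r -[X in (X < _)%N](expn0 p) ltn_exp2l ?prime_gt1.
  by rewrite -mulrnA; apply: indep => //; apply: block_lt.
exists x; move: nx; rewrite /max_list sE /= /g /n eqxx diffs_cat diffs_nseq.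
rewrite diffs_cat diffs_nseq iterSr.
have -> : [seq nseq (n i) (g i) | i <- s'] =
    [seq nseq (p ^ (e i - j) - 1) (k i *+ p ^ j) | i <- s'].
  apply/eq_in_map => i i_s'; rewrite /n /g; case: eqP => // ii0.
  by move: uniq_s; rewrite sE /= -ii0 i_s'.
set l := flatten _.
have -> : diff (k i0) (diffs l (delta a)) = diffs l (diff (k i0) (delta a)).
  by rewrite -diffs_cons.
rewrite mulnC iterM.
have -> // : diff (k i0 *+ p ^ j) = iter (p ^ j) (diff (k i0)) :> ((Z -> V) -> _).
by apply: funext => G; rewrite iter_diff_primeX.
Qed.

End PowerDifferences.

(** * Laws separating wreath products *)

Section AbelianAsAdditive.
Variables (B : groupType) (hB : abelian_group B).

(** The commutativity proof is a parameter of the type, so that the additive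
    structure can be inferred from the type. *)
Definition additive_of & abelian_group B : Type := B.
Local Notation Z := (additive_of hB).
HB.instance Definition _ := Choice.on Z.

Fact additive_ofA : associative (fun x y : Z => (x : B) * y : Z).
Proof. by move=> x y z; apply: mulgA. Qed.
Fact additive_ofC : commutative (fun x y : Z => (x : B) * y : Z).
Proof. by move=> x y; apply: hB. Qed.
Fact additive_of0 : left_id (1 : B) (fun x y : Z => (x : B) * y : Z).
Proof. by move=> x; apply: mul1g. Qed.
Fact additive_ofN :
  left_inverse (1 : B) (fun x : Z => (x : B)^-1 : Z) (fun x y : Z => (x : B) * y : Z).
Proof. by move=> x; apply: mulVg. Qed.
HB.instance Definition _ := GRing.isZmodule.Build Z
  additive_ofA additive_ofC additive_of0 additive_ofN.

Lemma additive_of_mulrn (x : Z) k : (x *+ k)%R = (x : B) ^+ k.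
Proof. by elim: k => // k IH; rewrite GRing.mulrS expgS IH. Qed.

End AbelianAsAdditive.

(** The subgroup [Omega_1(Z(A))] as an additive group: base functions with values
    in it form a module over the field with [p] elements, on which the active
    group acts by translations. *)
Definition omega1 (A : groupType) (p : nat) : Type :=
  {z : A | `[< (forall x, commute z x) /\ z ^+ p = 1 >]}.

Section Omega1.
Variables (A : groupType) (p : nat).
Local Notation U := (omega1 A p).
HB.instance Definition _ := Choice.on U.

Lemma omega1C (u : U) x : commute (val u) x.
Proof. by have /asboolP[] := valP u. Qed.

Lemma omega1p (u : U) : val u ^+ p = 1.
Proof. by have /asboolP[] := valP u. Qed.

Fact omega1_mul_subproof (u v : U) :
  `[< (forall x, commute (val u * val v) x) /\ (val u * val v) ^+ p = 1 >].
Proof.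
apply/asboolP; split=> [x|].
  by apply: commute_sym; apply: commuteM; apply: commute_sym; apply: omega1C.
by rewrite expgMn ?omega1p ?mulg1 //; apply: omega1C.
Qed.

Fact omega1_one_subproof : `[< (forall x : A, commute 1 x) /\ (1 : A) ^+ p = 1 >].
Proof.
by apply/asboolP; split=> [x|]; [apply: commute_sym; apply: commute1|rewrite expg1n].
Qed.

Fact omega1_inv_subproof (u : U) :
  `[< (forall x, commute (val u)^-1 x) /\ (val u)^-1 ^+ p = 1 >].
Proof.
apply/asboolP; split=> [x|]; last by rewrite expVgn omega1p invg1.
by apply: commute_sym; apply: commuteV; apply: commute_sym; apply: omega1C.
Qed.

Definition omega1_add (u v : U) : U := exist _ (val u * val v) (omega1_mul_subproof u v).
Definition omega1_zero : U := exist _ 1 omega1_one_subproof.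
Definition omega1_opp (u : U) : U := exist _ (val u)^-1 (omega1_inv_subproof u).

Fact omega1_addA : associative omega1_add.
Proof. by move=> u v w; apply: val_inj; rewrite /= mulgA. Qed.
Fact omega1_addC : commutative omega1_add.
Proof. by move=> u v; apply: val_inj; apply: omega1C. Qed.
Fact omega1_add0 : left_id omega1_zero omega1_add.
Proof. by move=> u; apply: val_inj; rewrite /= mul1g. Qed.
Fact omega1_addN : left_inverse omega1_zero omega1_opp omega1_add.
Proof. by move=> u; apply: val_inj; rewrite /= mulVg. Qed.
HB.instance Definition _ := GRing.isZmodule.Build U
  omega1_addA omega1_addC omega1_add0 omega1_addN.

Lemma omega1_mulrn (u : U) k : val (u *+ k)%R = val u ^+ k.
Proof. by elim: k => // k IH; rewrite GRing.mulrS expgS /= IH. Qed.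

Lemma omega1_mulrp (u : U) : (u *+ p)%R = 0%R.
Proof. by apply: val_inj; rewrite omega1_mulrn omega1p. Qed.

End Omega1.

Lemma eval_base (A B : groupType) (e : nat -> wreath A B) w :
  (forall i, (e i).1 = 1) ->
  eval e w = (1, fun x => eval (fun i => (e i).2 x) w).
Proof.
move=> e1; elim: w => [i||w1 IH1 w2 IH2|w IH] //=.
- by rewrite [e i]surjective_pairing e1.
- by rewrite IH1 IH2; congr pair; [apply: mulg1|apply: funext => x /=; rewrite invg1 mulg1].
- by rewrite IH; congr pair; [apply: invg1|apply: funext => x /=; rewrite mulg1].
Qed.

Lemma wreath_fst_exp (A B : groupType) (g : wreath A B) k :
  (g ^+ k).1 = g.1 ^+ k.
Proof. by elim: k => // k IH; rewrite !expgS -IH. Qed.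

Lemma wreath_base_exp (A B : groupType) (f : B -> A) k :
  ((1, f) : wreath A B) ^+ k = (1, fun x => f x ^+ k).
Proof.
elim: k => // k IH; rewrite expgS IH; congr pair; first exact: mulg1.
by apply: funext => x /=; rewrite invg1 mulg1 expgS.
Qed.

(** Test words have three kinds of variables: the passive ones [z i], the active
    ones [t i] that move them, and those [y i] along which differences are
    taken. *)
Definition interleave (T : Type) (z t y : nat -> T) (i : nat) : T :=
  if (i %% 3)%N == 0%N then z (i %/ 3)%N
  else if (i %% 3)%N == 1%N then t (i %/ 3)%N else y (i %/ 3)%N.

Lemma interleave0 T (z t y : nat -> T) i : interleave z t y (3 * i) = z i.
Proof. by rewrite /interleave mulnC modnMl /= mulnK. Qed.

Lemma interleave1 T (z t y : nat -> T) i : interleave z t y (3 * i + 1) = t i.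
Proof. by rewrite /interleave mulnC modnMDl /= divnMDl // addn0. Qed.

Lemma interleave2 T (z t y : nat -> T) i : interleave z t y (3 * i + 2) = y i.
Proof. by rewrite /interleave mulnC modnMDl /= divnMDl // addn0. Qed.

Fixpoint wcomms (w : word) (q s : nat) : word :=
  if s is s'.+1 then wcomm (wcomms w q s') (wpow (Var (3 * s' + 2)) q) else w.

Section BaseModule.
Variables (A B : groupType) (hB : abelian_group B) (p : nat).
Local Notation Z := (additive_of hB).
Local Notation U := (omega1 A p).

Definition in_base (F : Z -> U) : wreath A B := (1, fun x => val (F x)).

(** On central base functions, the commutator with an element of the wreath product
    depends on its active part only, and is the difference operator. *)
Lemma comm_in_base (F : Z -> U) (g : wreath A B) :
  [~ in_base F, g] = in_base (diff (g.1 : Z) F).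
Proof.
case: g => h g; rewrite /commg /conjg; congr pair => /=.
  by rewrite !mul1g mulVg mulg1 // invg1.
apply: funext => x /=.
have -> : x / (h^-1 * (1 * h)) * 1 = x by rewrite mul1g mulVg invg1 !mulg1.
have -> : x / (1 * h) * h = x by rewrite mul1g mulgVK.
have c u : commute (sval (F u)) (g x) by apply: omega1C.
rewrite (c (x / h)) mulKg; apply: commute_sym; exact: omega1C.
Qed.

Lemma eval_wcomms (e : nat -> wreath A B) w q s F :
  eval e w = in_base F ->
  eval e (wcomms w q s) =
  in_base (diffs (mkseq (fun l => ((e (3 * l + 2)).1 ^+ q : Z)) s) F).
Proof.
move=> eF; elim: s => [|s IH] //.
rewrite mkseqS diffs_rcons.
rewrite -[eval e _]/([~ eval e (wcomms w q s), eval e (wpow (Var (3 * s + 2)) q)]).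
by rewrite IH comm_in_base eval_wpow wreath_fst_exp.
Qed.

Lemma in_base_eq1 F : in_base F = 1 -> F = fun=> 0%R.
Proof.
by move=> /(congr1 snd) /= F1; apply: funext => x; apply/val_inj/(congr1 (@^~ x) F1).
Qed.

Lemma in_base0 : in_base (fun=> 0%R) = 1. Proof. by []. Qed.

End BaseModule.

Section CentralWord.
Variables (A : groupType) (p : nat) (v : word).
Hypotheses (vc : forall (e : nat -> A) x, commute (eval e v) x)
  (vp : forall e : nat -> A, eval e v ^+ p = 1).
Local Notation U := (omega1 A p).

Fact central_val_subproof (a : nat -> A) :
  `[< (forall x, commute (eval a v) x) /\ eval a v ^+ p = 1 >].
Proof. by apply/asboolP; split. Qed.

Definition central_val (a : nat -> A) : U :=
  exist _ (eval a v) (central_val_subproof a).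

Section TestWords.
Variables (B : groupType) (hB : abelian_group B) (d q s : nat).
Local Notation Z := (additive_of hB).

(** Both words substitute commutators into [v], so that its arguments fall into
    the base group.  The first one suits words [v] that die with any one of two
    variables, the second one words in one variable.  In the latter, the
    exponent [d] will be the part of [n] prime to [p], which moves the active
    parts into the [p]-primary component: the argument of [v] is then itself a
    difference along an element of that component. *)
Definition test_word2 : word :=
  wcomms (subst (fun i => wcomm (Var (3 * i)) (Var (3 * i + 1))) v) q s.

Definition test_word1 : word :=
  wcomms (subst (fun=> wcomm (wpow (Var (3 * 0)) d) (wpow (Var (3 * 0 + 1)) d)) v) q s.

Let delta (a : U) (z : Z) : U := if z == 0%R then a else 0%R.

Lemma commg_wreath1 (g h : wreath A B) : [~ g, h].1 = 1.
Proof.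
rewrite /commg /conjg -[LHS]/((g.1)^-1 * ((h.1)^-1 * (g.1 * h.1))).
by rewrite (hB g.1) mulKg mulVg.
Qed.

Lemma commg_wreath2 (g h : wreath A B) x :
  [~ g, h].2 x =
  (g.2 x)^-1 * ((h.2 (x * g.1^-1))^-1 * (g.2 (x * h.1^-1) * h.2 x)).
Proof.
case: g h => b f [c g]; rewrite /commg /conjg /= .
have -> : x / (c^-1 * (b * c)) * b = x.
  by rewrite (hB b) mulKg mulgVK.
have -> // : x / (b * c) * c = x / b.
by rewrite (hB b) invgM mulgA mulgVK.
Qed.

Lemma test_word2_law :
  (forall (ys : seq Z) (F : Z -> U) x, size ys = s ->
     (forall y, y \in ys -> exists z : Z, y = (z *+ q)%R) -> diffs ys F x = 0%R) ->
  satisfies (wreath A B) test_word2.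
Proof.
move=> ys0 e.
pose F (x : Z) := central_val
  (fun i => [~ e (3 * i)%N, e (3 * i + 1)%N].2 x).
rewrite (@eval_wcomms _ _ hB p _ _ _ _ F); last first.
  by rewrite eval_subst eval_base // => i; apply: commg_wreath1.
rewrite -(@in_base0 A B hB p); congr in_base; apply: funext => x.
apply: ys0 => [|y /mapP[l _ ->]]; first by rewrite size_mkseq.
by eexists; rewrite additive_of_mulrn.
Qed.

(** If [f] is supported at [1], then [[~ f, b]] is supported at [1] and [b].  For
    distinct [b] and [b'] two such supports meet in [1] only, so a word that
    dies with either of its arguments takes a value supported at one point. *)
Lemma test_word2_nonlaw (L : seq Z) (b b' : Z) i1 i2 :
  ~ satisfies A v -> i1 <> i2 ->
  (forall e : nat -> A, e i1 = 1 \/ e i2 = 1 -> eval e v = 1) ->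
  b <> 0%R -> b' <> 0%R -> b <> b' ->
  size L = s -> (forall y, y \in L -> exists z : Z, (z *+ q)%R = y) ->
  (forall a : U, a <> 0%R -> exists x, diffs L (delta a) x <> 0%R) ->
  ~ satisfies (wreath A B) test_word2.
Proof.
move=> nv i12 v12 b0 b'0 bb' sizeL rootL deltaL law.
have /existsNP[a va] := nv.
have [|root rootP] := @choice Z Z (fun y z => y \in L -> (z *+ q)%R = y).
  move=> y; have [/rootL[z zy]|_] := boolP (y \in L); last by exists 0%R.
  by exists z.
pose c i : Z := if i == i1 then b else b'.
have c0 i : c i <> 0%R by rewrite /c; case: eqP.
pose z i : wreath A B := (1, fun x => if x == 1 then (a i)^-1 else 1).
pose t i : wreath A B := (c i : B, fun=> 1).
pose y i : wreath A B := (root (nth 0%R L i) : B, fun=> 1).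
pose e := interleave z t y.
have lawe := law e.
have eE : eval e (subst (fun i => wcomm (Var (3 * i)) (Var (3 * i + 1))) v) =
    in_base (hB := hB) (delta (central_val a)).
  rewrite eval_subst eval_base => [|i]; last exact: commg_wreath1.
  congr pair; apply: funext => x.
  have tauE i : eval e (wcomm (Var (3 * i)) (Var (3 * i + 1))) = [~ z i, t i].
    by rewrite eval_wcomm /e /= interleave0 interleave1.
  under eq_fun do rewrite tauE commg_wreath2 /=.
  rewrite /delta; case: eqP => [->|x0].
    congr eval; apply: funext => i; rewrite invgK.
    have [/divg1_eq c1|_] := eqVneq; first by case: (c0 i).
    by rewrite invg1 !mul1g mulg1.
  rewrite v12 //.
  have tau1 i : x <> c i ->
      1^-1 * (1^-1 * ((if x / c i == 1 then (a i)^-1 else 1) * 1)) = 1.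
    by move=> xc; case: eqP => [/divg1_eq //|_]; rewrite invg1 !mulg1.
  have [xb|xb] := EM (x = b); [right|left]; apply: tau1; rewrite /c ?eqxx //.
  by rewrite ifN ?xb //; apply/eqP => ii; apply: i12.
move: lawe; rewrite /test_word2 (eval_wcomms _ _ eE) => /in_base_eq1 D0.
have [|x] := deltaL (central_val a).
  by move=> /(congr1 val).
apply; rewrite -[RHS]/((fun=> 0%R) x) -D0; congr (diffs _ _ x).
rewrite -[LHS](mkseq_nth 0%R) sizeL; apply/eq_in_map => l; rewrite mem_iota => l_lt.
by rewrite /e interleave2 /= -additive_of_mulrn rootP // mem_nth ?sizeL.
Qed.

Section OneVariable.
Hypothesis vM : forall x y : A,
  eval (fun=> x * y) v = eval (fun=> x) v * eval (fun=> y) v.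

Let phi (x : A) : U := central_val (fun=> x).

Let phiM x y : phi (x * y) = (phi x + phi y)%R.
Proof. by apply: val_inj; rewrite /= vM. Qed.

Let phi1 : phi 1 = 0%R. Proof. by apply: val_inj; rewrite /= eval_One. Qed.

Let phiV x : phi x^-1 = (- phi x)%R.
Proof.
by apply: (@GRing.addrI _ (phi x)); rewrite GRing.subrr -phiM mulgV phi1.
Qed.

Let phiX x k : phi (x ^+ k) = (phi x *+ k)%R.
Proof. by elim: k => [|k IH]; rewrite ?phi1 // expgS phiM IH GRing.mulrS. Qed.

(** Since [v] induces a homomorphism [phi] into an abelian group, the commutator of
    [b f] and [c g] is mapped to [(T_c - 1) (phi f) - (T_b - 1) (phi g)]. *)
Lemma eval_test_word1 (e : nat -> wreath A B) :
  let g := e 0%N ^+ d in let h := e 1%N ^+ d in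
  eval e (subst (fun=> wcomm (wpow (Var (3 * 0)) d) (wpow (Var (3 * 0 + 1)) d)) v)
  = in_base (hB := hB)
     (fun x => diff (h.1 : Z) (phi \o g.2) x - diff (g.1 : Z) (phi \o h.2) x)%R.
Proof.
move=> g h; rewrite eval_subst eval_base => [|i].
  congr pair; apply: funext => x.
  under eq_fun do rewrite eval_wcomm !eval_wpow -/g -/h commg_wreath2.
  rewrite -[LHS]/(val (phi _)) !phiM !phiV; congr val.
  rewrite /diff /= GRing.opprB [RHS]GRing.addrACA [RHS]GRing.addrC.
  by rewrite [LHS]GRing.addrA.
by rewrite eval_wcomm commg_wreath1.
Qed.

Lemma test_word1_law :
  (forall (h : Z) (ys : seq Z) (F : Z -> U) x, size ys = s ->
     (exists z : Z, h = (z *+ d)%R) ->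
     (forall y, y \in ys -> exists z : Z, y = (z *+ q)%R) ->
     diffs ys (diff h F) x = 0%R) ->
  satisfies (wreath A B) test_word1.
Proof.
move=> ys0 e; rewrite (eval_wcomms _ _ (eval_test_word1 e)).
rewrite -(@in_base0 A B hB p); congr in_base; apply: funext => x.
rewrite diffsD diffsN !ys0 ?GRing.subr0 ?size_mkseq //.
- by exists (e 0%N).1; rewrite wreath_fst_exp additive_of_mulrn.
- by move=> y /mapP[l _ ->]; eexists; rewrite additive_of_mulrn.
- by exists (e 1%N).1; rewrite wreath_fst_exp additive_of_mulrn.
- by move=> y /mapP[l _ ->]; eexists; rewrite additive_of_mulrn.
Qed.

Lemma test_word1_nonlaw (h : Z) (L : seq Z) :
  ~ satisfies A v ->
  (exists i, forall e : nat -> A, eval e v = eval (fun=> e i) v) ->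
  (0 < p)%N -> coprime p d -> size L = s ->
  (exists z : Z, (z *+ d)%R = h) ->
  (forall y, y \in L -> exists z : Z, (z *+ q)%R = y) ->
  (forall a : U, a <> 0%R -> exists x, diffs L (diff h (delta a)) x <> 0%R) ->
  ~ satisfies (wreath A B) test_word1.
Proof.
move=> nv [i vi] p_gt0 pd sizeL [c ch] rootL deltaL law.
have /existsNP[a va] := nv.
have [|root rootP] := @choice Z Z (fun y z => y \in L -> (z *+ q)%R = y).
  move=> y; have [/rootL[z zy]|_] := boolP (y \in L); last by exists 0%R.
  by exists z.
pose z (_ : nat) : wreath A B := (1, fun x => if x == 1 then a i else 1).
pose t (_ : nat) : wreath A B := (c : B, fun=> 1).
pose y l : wreath A B := (root (nth 0%R L l) : B, fun=> 1).
pose e := interleave z t y.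
have := law e; rewrite /test_word1 (eval_wcomms _ _ (eval_test_word1 e)).
move=> /in_base_eq1 D0.
have [|x] := deltaL (phi (a i) *+ d)%R.
  move=> ad; apply: va; rewrite vi -[LHS]/(val (phi (a i))).
  suff -> : phi (a i) = 0%R by [].
  have [r r' + _] := egcdnP d p_gt0; rewrite (eqP pd) => rE.
  have := congr1 (fun k => phi (a i) *+ k)%R rE.
  rewrite /= GRing.mulrnDr [(r * p)%N]mulnC [(r' * d)%N]mulnC !GRing.mulrnA ad.
  by rewrite (omega1_mulrp (phi (a i))) !GRing.mul0rn GRing.add0r GRing.mulr1n => <-.
apply; rewrite -[RHS]/((fun=> 0%R) x) -D0 => {D0}.
have -> : mkseq (fun l => (e (3 * l + 2)%N).1 ^+ q : Z) s = L.
  rewrite -[RHS](mkseq_nth 0%R) sizeL; apply/eq_in_map => l; rewrite mem_iota => l_lt.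
  by rewrite /e interleave2 /= -additive_of_mulrn rootP // mem_nth ?sizeL.
congr (diffs _ _ x); apply: funext => u.
have -> : e 0%N = z 0%N by apply: (interleave0 z t y 0).
have -> : e 1%N = t 0%N by apply: (interleave1 z t y 0).
rewrite !wreath_fst_exp /= expg1n -additive_of_mulrn ch.
have diff1 (G : Z -> U) : diff ((1%g : B) : Z) G u = 0%R.
  by rewrite /diff (GRing.subr0 (u : Z)) GRing.subrr.
rewrite diff1 GRing.subr0; congr diff; apply: funext => w.
rewrite wreath_base_exp /= phiX /delta -[(1%g : B)]/(0%R : Z).
by case: eqP => // _; rewrite phi1 GRing.mul0rn.
Qed.

End OneVariable.
End TestWords.
End CentralWord.

(** The test word takes as many differences as do not annihilate a point mass over
    [B2]; over [B1] these are too many.  When the central word has one variable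
    only, its value is already a difference of a point mass.  For [j = 0] this
    one has to be counted among the differences; for [j > 0] it is taken along
    a generator, not along a [p^j]-th multiple, and does no harm
    ([diffs_max_list_head]). *)
Lemma wreath_law_separates (A B1 B2 : groupType) (hB1 : abelian_group B1)
    (hB2 : abelian_group B2) m p d j
    (I1 I2 : eqType) (g1 : I1 -> additive_of hB1) (d1 : I1 -> nat) (s1 : seq I1)
    (sp : seq I2 -> set (additive_of hB2)) (k : I2 -> additive_of hB2)
    (e : I2 -> nat) (s2 : seq I2) (b b' : additive_of hB2) :
  nilpotent_group A -> has_exponent A m -> prime p -> (p %| m)%N -> coprime p d ->
  (forall i, i \in s1 -> g1 i *+ (p ^ d1 i) = 0)%R ->
  (forall y : additive_of hB1, gen_by g1 s1 (y *+ (d * p ^ j))%R) ->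
  (forall t, sp t 0%R) ->
  (forall t x y, sp t x -> sp t y -> sp t (x - y)%R) ->
  (forall i t x c, sp t x -> sp (i :: t) (x + k i *+ c)%R) ->
  (forall i t, uniq (i :: t) -> {subset i :: t <= s2} ->
     forall c, (0 < c < p ^ e i)%N -> ~ sp t (k i *+ c)%R) ->
  uniq s2 -> (forall i, i \in s2 -> (j < e i)%N) ->
  (forall i, i \in s2 -> k i *+ p ^ e i = 0)%R ->
  b <> 0%R -> b' <> 0%R -> b <> b' ->
  (\sum_(i <- s1) (p ^ d1 i - 1) < \sum_(i <- s2) (p ^ (e i - j) - 1))%N ->
  exists w, satisfies (wreath A B1) w /\ ~ satisfies (wreath A B2) w.
Proof.
move=> nilA expA p_pr p_m pd gd1 gen1 sp0 spB spS indep uniq_s ltje ke b0 b'0 bb' lt12.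
have [v [nv vc vp [[i1 [i2 [i12 v12]]]|[vM vi]]]] := central_word_cases nilA expA p_pr p_m.
  exists (test_word2 v (d * p ^ j) (size (max_list k p j e s2))); split.
    apply: (test_word2_law vc vp (hB := hB1)) => ys F x size_ys rootys.
    apply: (diffs_eq0 p_pr (@omega1_mulrp A p) gd1).
      by move=> y /rootys[z ->].
    by rewrite size_ys size_max_list.
  apply: (test_word2_nonlaw (i1 := i1) (i2 := i2) vc vp nv _ _ b0 b'0 bb' erefl) => //.
    by move=> y; apply: max_list_root.
  by move=> a; apply: (diffs_max_list p_pr sp0 spB spS indep uniq_s ltje).
have p_gt0 := prime_gt0 p_pr.
case: s2 uniq_s ltje ke indep lt12 => [|i0 s2] uniq_s ltje ke indep lt12.
  by rewrite big_nil ltn0 in lt12.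
set L := max_list k p j e (i0 :: s2).
have rootL y : y \in L -> exists z, (z *+ (d * p ^ j))%R = y.
  by apply: max_list_root.
have [j0|j_gt0] := posnP j.
  have [y0 [L' LE]] : exists y0 L', L = y0 :: L'.
    have : (0 < size L)%N by rewrite size_max_list (leq_ltn_trans _ lt12).
    by case: L {rootL} => // y0 L'; exists y0, L'.
  exists (test_word1 v d (d * p ^ j) (size L')); split.
    apply: (test_word1_law vc vp (hB := hB1) vM) => h ys F x size_ys [z hz] rootys.
    rewrite -[LHS]/(diffs (h :: ys) F x).
    apply: (diffs_eq0 p_pr (@omega1_mulrp A p) gd1).
      move=> y; rewrite inE => /predU1P[->|/rootys[z' ->]] //.
      by have := gen1 z; rewrite j0 expn0 muln1 hz.
    by rewrite /= size_ys -[X in (_ < X)%N]/(size (y0 :: L')) -LE size_max_list.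
  apply: (test_word1_nonlaw (L := L') (h := y0) vc vp vM nv vi p_gt0 pd erefl).
  - have [|z zy] := rootL y0; first by rewrite LE inE eqxx.
    by exists z; rewrite -zy j0 expn0 muln1.
  - by move=> y yL'; apply: rootL; rewrite LE inE yL' orbT.
  - move=> a a0; have [x] := diffs_max_list p_pr sp0 spB spS indep uniq_s ltje a0.
    by rewrite -/L LE; exists x.
exists (test_word1 v d (d * p ^ j) (size L)); split.
  apply: (test_word1_law vc vp (hB := hB1) vM) => h ys F x size_ys _ rootys.
  apply: (diffs_eq0 p_pr (@omega1_mulrp A p) gd1).
    by move=> y /rootys[z ->].
  by rewrite size_ys size_max_list.
apply: (test_word1_nonlaw (L := L) (h := k i0) vc vp vM nv vi p_gt0 pd erefl) => //.
- have d_gt0 : (0 < d)%N.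
    by case: d pd {gen1 rootL} => //; rewrite /coprime gcdn0 => /eqP p1; move: p_pr; rewrite p1.
  have [r _] := Bezoutl (p ^ e i0) d_gt0.
  rewrite gcdnC (eqP (coprimeXl _ pd)) => /dvdnP[q qE].
  exists (k i0 *+ q)%R; rewrite -GRing.mulrnA -qE GRing.mulrnDr GRing.mulr1n.
  by rewrite mulnC GRing.mulrnA ke ?inE ?eqxx // GRing.mul0rn GRing.addr0.
- move=> a a0.
  exact: (diffs_max_list_head p_pr (@omega1_mulrp A p) sp0 spB spS indep uniq_s ltje erefl).
Qed.

(** * Bases of abelian groups of prime power exponent *)

Section Bases.
Local Open Scope ring_scope.
Import GRing.Theory.
Variable Z : zmodType.
Implicit Types (x y z : Z) (X L S : set Z) (s l : seq Z).

Lemma mulrn_gcd y a b : y *+ a = 0 -> y *+ b = 0 -> y *+ gcdn a b = 0.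
Proof.
have [->|b_gt0] := posnP b; first by rewrite gcdn0.
move=> ya yb; have [r r' + _] := egcdnP a b_gt0; rewrite gcdnC => rE.
have := congr1 (fun k => y *+ k) rE.
by rewrite /= mulrnDr [(r * b)%N]mulnC [(r' * a)%N]mulnC !mulrnA ya yb !mul0rn
  add0r.
Qed.

Lemma pexp_order p y e k : prime p -> y *+ p ^ e <> 0 -> y *+ p ^ e.+1 = 0 ->
  y *+ k = 0 -> (p ^ e.+1 %| k)%N.
Proof.
move=> p_pr ye ye1 yk; have := mulrn_gcd ye1 yk.
have /dvdn_pfactor -/(_ p_pr) [f fe gE] := dvdn_gcdl (p ^ e.+1) k.
move: fe; rewrite leq_eqVlt => /predU1P[fe|fe yg].
  by rewrite -fe -gE => _; apply: dvdn_gcdr.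
by case: ye; rewrite -(subnKC (fe : (f <= e)%N)) expnD mulrnA -gE yg mul0rn.
Qed.

(** In a group of finite exponent the sums with repetitions form the subgroup
    generated by [X]. *)
Definition nspan X y := exists2 l, (forall x, x \in l -> X x) & y = \sum_(x <- l) x.

Definition independent X := ~ X 0 /\
  forall s, uniq s -> (forall x, x \in s -> X x) ->
  forall c : Z -> nat, \sum_(x <- s) x *+ c x = 0 ->
  forall x, x \in s -> x *+ c x = 0.

Lemma nspan0 X : nspan X 0. Proof. by exists [::]; rewrite ?big_nil. Qed.

Lemma nspanD X y z : nspan X y -> nspan X z -> nspan X (y + z).
Proof.
move=> [l lX ->] [l' l'X ->]; exists (l ++ l'); last by rewrite big_cat.
by move=> x; rewrite mem_cat => /orP[/lX|/l'X].
Qed.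

Lemma nspan1 X x : X x -> nspan X x.
Proof. by move=> Xx; exists [:: x]; rewrite ?big_seq1 // => y; rewrite inE => /eqP->. Qed.

Lemma nspanMn X y k : nspan X y -> nspan X (y *+ k).
Proof.
move=> Xy; elim: k => [|k IH]; first exact: nspan0.
by rewrite mulrS; apply: nspanD.
Qed.

Lemma nspan_sum X (I : eqType) (l : seq I) (F : I -> Z) :
  (forall i, i \in l -> nspan X (F i)) -> nspan X (\sum_(i <- l) F i).
Proof.
elim: l => [|i l IH] lX; first by rewrite big_nil; apply: nspan0.
rewrite big_cons; apply: nspanD; first by apply: lX; rewrite inE eqxx.
by apply: IH => j jl; apply: lX; rewrite inE jl orbT.
Qed.

Lemma sub_nspan X Y y : X `<=` Y -> nspan X y -> nspan Y y.
Proof. by move=> XY [l lX ->]; exists l => // x /lX /XY. Qed.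

Lemma nspan_coef X y : nspan X y -> exists s (c : Z -> nat),
  [/\ uniq s, forall x, x \in s -> X x & y = \sum_(x <- s) x *+ c x].
Proof.
move=> [l lX ->]; exists (undup l), (fun x => count_mem x l); split.
- exact: undup_uniq.
- by move=> x; rewrite mem_undup => /lX.
- by rewrite -big_undup_iterop_count.
Qed.

Section Torsion.
Variable n : nat.
Hypotheses (n_gt0 : (0 < n)%N) (Zn : forall x : Z, x *+ n = 0).

Lemma nspanN X y : nspan X y -> nspan X (- y).
Proof.
move=> /(@nspanMn _ _ n.-1); suff -> : y *+ n.-1 = - y by [].
by apply/eqP; rewrite -addr_eq0 -mulrSr prednK // Zn.
Qed.

Lemma nspanB X y z : nspan X y -> nspan X z -> nspan X (y - z).
Proof. by move=> Xy Xz; apply/nspanD/nspanN. Qed.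

Variable p : nat.
Hypothesis p_pr : prime p.

Lemma independentU1 X y : independent X -> y *+ p = 0 -> ~ nspan X y ->
  independent (X `|` [set y]).
Proof.
move=> [X0 Xind] yp nXy; split=> [[//|/= y0]|s s_uniq sX c sc0].
  by apply: nXy; rewrite -y0; apply: nspan0.
have [ys|ys] := boolP (y \in s); last first.
  apply: Xind => // x xs; case: (sX x xs) => // /= xy.
  by rewrite -xy xs in ys.
have ry_s x : x \in rem y s -> X x.
  rewrite (rem_filter _ s_uniq) mem_filter /= => /andP[/eqP xy xs].
  by case: (sX x xs).
move: sc0; rewrite (big_rem y ys) /= => sc0.
have yc0 : y *+ c y = 0.
  have [/dvdnP[k ->]|ncy] := boolP (p %| c y)%N.
    by rewrite mulnC mulrnA yp mul0rn.
  case: nXy; have c_gt0 : (0 < c y)%N by case: (c y) ncy; rewrite ?dvdn0.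
  have [r r' + _] := egcdnP p c_gt0.
  have /eqP -> : coprime (c y) p by rewrite coprime_sym prime_coprime.
  move=> /(congr1 (fun k => y *+ k)) /=.
  rewrite mulrnDr [(r' * p)%N]mulnC [(y *+ (p * _))]mulrnA yp mul0rn add0r mulr1n.
  move=> <-; rewrite mulnC mulrnA; apply: nspanMn.
  have -> : y *+ c y = - \sum_(x <- rem y s) x *+ c x.
    by apply/eqP; rewrite -addr_eq0 sc0.
  by apply/nspanN/nspan_sum => x /ry_s Xx; apply/nspanMn/nspan1.
move=> x xs; have [-> //|xy] := eqVneq x y.
apply: (Xind (rem y s)) => //; first exact: rem_uniq.
  by move: sc0; rewrite yc0 add0r.
by rewrite rem_filter // mem_filter /= xy.
Qed.

(** An independent set extends to a basis, by a maximality argument. *)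
Lemma extend_independent S L : L `<=` S -> (forall x, S x -> x *+ p = 0) ->
  independent L ->
  exists L', [/\ L `<=` L', L' `<=` S, independent L' & S `<=` nspan L'].
Proof.
move=> LS Sp Lind.
pose P Y := Y `<=` S /\ independent (L `|` Y).
have [F FP Ftot|Y [[YS Yind] Ymax]] := @Zorn_bigcup Z P.
  split=> [x [Y FY Yx]|]; first by have [YS _] := FP _ FY; apply: YS.
  split=> [[|[Y FY Y0]]|s s_uniq sF c sc0]; first by case: Lind.
    by have [_ [nLY _]] := FP _ FY; apply: nLY; right.
  have [sL|[Y FY sY]] : (forall x, x \in s -> L x) \/
      exists2 Y, F Y & forall x, x \in s -> (L `|` Y) x.
    elim: s sF {s_uniq sc0} => [|x s IH] sF; first by left.
    have sF' y : y \in s -> (L `|` \bigcup_(X in F) X) y.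
      by move=> ys; apply: sF; rewrite inE ys orbT.
    have [Lx|[X FX Xx]] : (L `|` \bigcup_(X in F) X) x.
      by apply: sF; rewrite inE eqxx.
      have [sL|[Y FY sY]] := IH sF'; [left|right; exists Y => //] => y.
        by rewrite inE => /predU1P[->|/sL].
      by rewrite inE => /predU1P[->|/sY //]; left.
    right; have [sL|[Y FY sY]] := IH sF'.
      by exists X => // y; rewrite inE => /predU1P[->|/sL]; [right|left].
    have [XY|YX] := Ftot X Y FX FY.
      exists Y => // y; rewrite inE => /predU1P[->|/sY //].
      by right; apply: XY.
    exists X => // y; rewrite inE => /predU1P[->|/sY]; first by right.
    by move=> [Ly|/YX Xy]; [left|right].
  - by have [_ Lindep] := Lind; apply: (Lindep s).
  - by have [_ [_ Yindep]] := FP _ FY; apply: (Yindep s).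
exists (L `|` Y); split=> [x Lx|x [/LS|/YS] //|//|x Sx]; first by left.
apply: contrapT => nx.
apply: (Ymax (Y `|` [set x])).
  split=> [y Yy|/(_ x)]; first by left.
  by move=> Yx; apply: nx; apply: nspan1; right; apply: Yx; right.
split; first by move=> y [/YS //|->].
by rewrite setUA; apply: independentU1 => //; apply: Sp.
Qed.

Let primary_elt x := exists k, x *+ p ^ k = 0.
Let u := logn p n.

Let primary_exp x : primary_elt x -> x *+ p ^ u = 0.
Proof.
move=> [k xk]; have := mulrn_gcd (Zn x) xk.
have /dvdn_pfactor -/(_ p_pr) [f fk gE] := dvdn_gcdr n (p ^ k).
rewrite gE => xf; have fu : (f <= u)%N.
  by rewrite /u -pfactor_dvdn // -gE dvdn_gcdl.
by rewrite -(subnKC fu) expnD mulrnA xf mul0rn.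
Qed.

Let socle t : set Z :=
  [set x | x *+ p = 0 /\ exists2 y, primary_elt y & x = y *+ p ^ t].

Let socle_filtered_basis k : exists L,
  [/\ L `<=` socle (u - k), independent L
    & forall t, (u - k <= t)%N -> socle t `<=` nspan (L `&` socle t)].
Proof.
elim: k => [|k [L [LS Lind Lspan]]].
  exists set0; split=> //; first by split=> // s _ s0 c _ x /s0.
  move=> t; rewrite subn0 => ut x [_ [y /primary_exp yu ->]].
  by rewrite -(subnKC ut) expnD mulrnA yu mul0rn; apply: nspan0.
have sub_socle t t' : (t <= t')%N -> socle t' `<=` socle t.
  move=> tt' x [xp [y [j yj] xE]]; split=> //.
  exists (y *+ p ^ (t' - t)); last by rewrite xE -mulrnA -expnD subnK.
  by exists j; rewrite -mulrnA mulnC mulrnA yj mul0rn.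
have [||L' [LL' L'S L'ind SL']] := @extend_independent (socle (u - k.+1)) L _ _ Lind.
- by move=> x /LS; apply: sub_socle; apply: leq_sub2l.
- by move=> x [].
exists L'; split=> // t; rewrite leq_eqVlt => /predU1P[<-|lt_t] x Sx.
  by apply: sub_nspan (SL' _ Sx) => y L'y; split=> //; apply: L'S.
apply: (@sub_nspan (L `&` socle t)) => [y [Ly Sy]|].
  by split=> //; apply: LL'.
apply: Lspan => //; move: lt_t; rewrite subnS; case: (u - k)%N => //.
Qed.

Definition basis_of (X : set Z) :=
  [/\ forall x, X x -> exists k, x *+ p ^ k = 0, independent X
    & forall y, (exists k, y *+ p ^ k = 0) -> nspan X y].

(** Choose bases of the layers [p^t P [p]] of the socle that extend each other,
    [t] decreasing, and let [lift x] be a root of [x] of the largest possible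
    order [p^(height x + 1)].  The lifts are independent because the multiples
    of them of order [p] are multiples of the [x]; they generate because an
    element of order [p^(t+1)] agrees up to order [p^t] with a combination of
    lifts. *)
Theorem exists_basis : exists X, basis_of X.
Proof.
have [L [LS [L0 Lind] Lspan]] := socle_filtered_basis u.
rewrite subnn in LS Lspan.
pose lift_spec x (yh : Z * nat) := L x ->
  [/\ primary_elt yh.1, yh.1 *+ p ^ yh.2 = x
    & forall t, socle t x -> (t <= yh.2)%N].
have [|lift_height lhP] := @choice Z (Z * nat)%type lift_spec.
  move=> x; have [Lx|nLx] := EM (L x); last by exists (0, 0%N).
  have ex_t : exists t, `[< socle t x >] by exists 0%N; apply/asboolP/LS.
  have bound_t t : `[< socle t x >] -> (t <= u)%N.
    move=> /asboolP[_ [y /primary_exp yu xE]]; rewrite leqNgt; apply/negP => ut.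
    apply: L0; suff <- : x = 0 by [].
    by rewrite xE -(subnKC (ltnW ut)) expnD mulrnA yu mul0rn.
  case: (ex_maxnP ex_t bound_t) => h /asboolP[xp [y Py xE]] hmax.
  by exists (y, h) => _; split=> // t /asboolP /hmax.
pose lift x := (lift_height x).1; pose h x := (lift_height x).2.
have liftP x : L x -> primary_elt (lift x) by move=> /lhP[].
have liftE x : L x -> lift x *+ p ^ h x = x by move=> /lhP[].
have h_max x t : L x -> socle t x -> (t <= h x)%N by move=> /lhP[_ _]; apply.
pose X := lift @` L.
have [|r rP] := @choice Z Z (fun y x => X y -> L x /\ lift x = y).
  by move=> y; have [[x Lx xy]|nX] := EM (X y); [exists x|exists 0].
have Lneq0 x : L x -> x <> 0 by move=> + x0; rewrite x0.
have Lp x : L x -> x *+ p = 0 by move=> /LS[].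
exists X; split=> [_ [x /liftP Px <-] //||].
  split=> [[x Lx lx0]|s s_uniq sX c sc0].
    by apply: (Lneq0 x Lx); rewrite -(liftE x Lx) lx0 mul0rn.
  have ex_T : exists T, all (fun y => y *+ c y *+ p ^ T == 0) s.
    exists u; apply/allP => y /sX [x /liftP /primary_exp xu <-].
    by rewrite -mulrnA mulnC mulrnA xu mul0rn.
  case: (ex_minnP ex_T) => -[|T] /allP sT Tmin.
    by move=> y /sT; rewrite mulr1n => /eqP.
  (* the relation multiplied by [p^T] is one between elements of order p *)
  have [c' c'P] : {c' : Z -> nat & forall y, y \in s ->
      y *+ c y *+ p ^ T = r y *+ c' y}.
    apply: (@choice Z nat (fun y k => y \in s -> y *+ c y *+ p ^ T = r y *+ k)) => y.
    have [ys|] := boolP (y \in s); last by exists 0%N.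
    have [Lr lrE] := rP y (sX y ys).
    have yh : y *+ p ^ h (r y) = r y by rewrite -{1}lrE liftE.
    have /dvdnP[k kE] : (p ^ (h (r y)).+1 %| c y * p ^ T.+1)%N.
      apply: (@pexp_order p y) => //.
      - by rewrite yh; apply: Lneq0.
      - by rewrite expnSr mulrnA yh Lp.
      - by rewrite mulrnA; apply/eqP/sT.
    exists k => _; rewrite -{1}yh -!mulrnA; congr (_ *+ _).
    apply/eqP; rewrite -(eqn_pmul2r (prime_gt0 p_pr)) -!mulnA -expnSr kE.
    by rewrite expnSr mulnCA.
  have : all (fun y => y *+ c y *+ p ^ T == 0) s.
    apply/allP => y ys; rewrite c'P //; apply/eqP.
    have := Lind (map r s) _ _ (c' \o lift) _ (r y); rewrite /=.
    have [_ ->] := rP y (sX y ys); apply=> //.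
    + rewrite map_inj_in_uniq // => y1 y2 ys1 ys2 y12.
      have [_ <-] := rP y1 (sX y1 ys1); have [_ <-] := rP y2 (sX y2 ys2).
      by rewrite y12.
    + by move=> _ /mapP[y' /sX /rP[Ly' _] ->].
    + rewrite big_map -[RHS](mul0rn _ (p ^ T)) -[in RHS]sc0 -sumrMnl [LHS]big_seq [RHS]big_seq.
      apply: eq_bigr => y' ys' /=; have [_ ->] := rP y' (sX y' ys').
      by rewrite c'P.
    + exact: map_f.
  by move=> /Tmin; rewrite ltnn.
move=> y [t]; elim: t y => [|t IH] y yt.
  by rewrite mulr1n in yt; rewrite yt; apply: nspan0.
have Sy : socle t (y *+ p ^ t).
  split; first by rewrite -mulrnA -expnSr.
  by exists y => //; exists t.+1.
have [l lLS yl] := Lspan t isT _ Sy.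
pose y' := \sum_(x <- l) lift x *+ p ^ (h x - t).
have Xy' : nspan X y'.
  by apply: nspan_sum => x /lLS[Lx _]; apply/nspanMn/nspan1; exists x.
rewrite -(subrK y' y); apply: nspanD => //; apply: IH.
rewrite mulrnBl yl -sumrMnl [X in _ - X]big_seq [X in X - _]big_seq.
apply/eqP; rewrite subr_eq0; apply/eqP/eq_bigr => x /lLS[Lx Sx].
by rewrite -mulrnA -expnD subnK ?liftE //; apply: h_max.
Qed.

End Torsion.
End Bases.

Section BasisLevels.
Local Open Scope ring_scope.
Import GRing.Theory.
Variable Z : zmodType.
Implicit Types (x y z : Z) (X : set Z).
Variables (n p : nat).
Hypotheses (n_gt0 : (0 < n)%N) (Zn : forall x : Z, x *+ n = 0) (p_pr : prime p).

Definition exponent_of x : nat :=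
  xget 0%N [set e | x *+ p ^ e = 0 /\ forall k, x *+ p ^ k = 0 -> (e <= k)%N].

Lemma exponent_ofP x : (exists k, x *+ p ^ k = 0) ->
  x *+ p ^ exponent_of x = 0 /\ forall k, x *+ p ^ k = 0 -> (exponent_of x <= k)%N.
Proof.
move=> [k xk]; pose P e := x *+ p ^ e == 0.
have exP : exists e, P e by exists k; apply/eqP.
case: (ex_minnP exP) => e /eqP xe emin.
apply: (@xgetPex _ 0%N
  [set e | x *+ p ^ e = 0 /\ forall k, x *+ p ^ k = 0 -> (e <= k)%N]).
by exists e; split=> // j xj; apply/emin/eqP.
Qed.

Lemma exponent_of_dvd x k : (exists k, x *+ p ^ k = 0) ->
  x *+ k = 0 <-> (p ^ exponent_of x %| k)%N.
Proof.
move=> /exponent_ofP [xe emin]; split=> [xk|/dvdnP[j ->]]; last first.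
  by rewrite mulnC mulrnA xe mul0rn.
case E : (exponent_of x) xe emin => [|e] xe emin; first by rewrite dvd1n.
by apply: (pexp_order p_pr _ xe xk) => /emin; rewrite ltnn.
Qed.

Lemma exponent_of_gt0 x : (exists k, x *+ p ^ k = 0) -> x <> 0 ->
  (0 < exponent_of x)%N.
Proof.
move=> /exponent_ofP [xe _] x0; rewrite lt0n; apply/eqP => e0.
by move: xe; rewrite e0 expn0 mulr1n.
Qed.

Lemma exponent_of_le x : (exists k, x *+ p ^ k = 0) ->
  (exponent_of x <= logn p n)%N.
Proof.
move=> xP; have /exponent_of_dvd -/(_ xP) := Zn x.
by rewrite pfactor_dvdn.
Qed.

Definition level X e : set Z := [set x | X x /\ exponent_of x = e].

Lemma basis_neq0 X x : basis_of p X -> X x -> x <> 0.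
Proof. by move=> [_ [X0 _] _] Xx x0; rewrite x0 in Xx. Qed.

Lemma level0 X : basis_of p X -> level X 0 = set0.
Proof.
move=> bX; apply/seteqP; split=> // x [Xx ex]; have [XP _ _] := bX.
by have := exponent_of_gt0 (XP x Xx) (basis_neq0 bX Xx); rewrite ex.
Qed.

Lemma level_big X e : basis_of p X -> (logn p n < e)%N -> level X e = set0.
Proof.
move=> [XP _ _] ue; apply/seteqP; split=> // x [Xx ex].
by have := exponent_of_le (XP x Xx); rewrite ex leqNgt ue.
Qed.

(** The relations between basis elements are determined by their orders; with
    [gen_isog] this makes groups with matching bases isomorphic. *)
Lemma basis_relation X (K : eqType) (b : K -> Z) (l : seq K) :
  basis_of p X -> injective b -> (forall k, X (b k)) ->
  \sum_(k <- l) b k = 0 <->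
  forall k, (p ^ exponent_of (b k) %| count_mem k l)%N.
Proof.
move=> [XP [X0 Xind] _] b_inj Xb.
have -> : \sum_(k <- l) b k = \sum_(k <- undup l) b k *+ count_mem k l.
  by rewrite -big_undup_iterop_count.
have countb k : count_mem (b k) (map b l) = count_mem k l.
  by rewrite count_map; apply: eq_count => j /=; rewrite (inj_eq b_inj).
split=> [sum0 k|dvd_count]; last first.
  by apply: big1_seq => k _; apply/exponent_of_dvd => //; apply: XP.
have [kl|kl] := boolP (k \in l); last by rewrite (count_memPn kl) dvdn0.
apply/exponent_of_dvd; first exact: XP.
rewrite -countb.
apply: (Xind (map b (undup l)) _ _ (fun x => count_mem x (map b l))).
- by rewrite map_inj_uniq ?undup_uniq.
- by move=> _ /mapP[j _ ->].
- by rewrite big_map -[RHS]sum0; apply: eq_bigr => j _; rewrite countb.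
- by rewrite map_f // mem_undup.
Qed.

Lemma finite_nspan X : finite_set X -> finite_set (nspan X).
Proof.
move=> /finite_seqP[s ->]; elim: s => [|x s IH].
  apply: (@sub_finite_set _ _ [set 0]); last exact: finite_set1.
  move=> y [[|z l] lX ->]; first by rewrite big_nil.
  by have := lX z; rewrite inE eqxx /= => /(_ isT).
apply: (@sub_finite_set _ _
  [set x *+ c + y | c in `I_n & y in nspan [set` s]]); last first.
  by apply: finite_image2 => //; apply: finite_II.
move=> _ [l lX ->]; exists (count_mem x l %% n)%N; first by rewrite /= ltn_pmod.
exists (\sum_(z <- l | z != x) z).
  rewrite -big_filter; exists [seq z <- l | z != x] => // z.
  by rewrite mem_filter => /andP[/negPf zx /lX]; rewrite /= inE zx.
have -> : x *+ (count_mem x l %% n) = x *+ count_mem x l.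
  by rewrite {2}(divn_eq (count_mem x l) n) mulrnDr mulnC mulrnA Zn mul0rn add0r.
rewrite [RHS](bigID (fun z => z == x)) /=; congr (_ + _).
rewrite -sum1_count -sumrMnr; apply: eq_bigr => z /eqP -> //.
Qed.

End BasisLevels.

(** In a group of exponent [n], an equation between two sums amounts to the
    vanishing of one sum, [n - 1] copies of an element being its opposite.  So
    equal relations make the map that sends one generating family to the other
    well defined and injective. *)
Lemma gen_isog (G H : groupType) (hG : abelian_group G) (hH : abelian_group H)
    n (K : Type) (b : K -> additive_of hG) (c : K -> additive_of hH)
    (P : set G) (Q : set H) :
  (0 < n)%N -> (forall x : G, x ^+ n = 1) ->
  (forall y, P y <-> exists l, y = (\sum_(k <- l) b k)%R) ->
  (forall y, Q y <-> exists l, y = (\sum_(k <- l) c k)%R) ->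
  (forall l, (\sum_(k <- l) b k = 0)%R <-> (\sum_(k <- l) c k = 0)%R) ->
  set_isog P Q.
Proof.
move=> n_gt0 Gn PE QE bc.
have bcE l l' : (\sum_(k <- l) b k = \sum_(k <- l') b k)%R <->
    (\sum_(k <- l) c k = \sum_(k <- l') c k)%R.
  pose l1 := flatten (nseq n.-1 l').
  have sum_l1 (V : zmodType) (f : K -> V) :
      (\sum_(k <- l1) f k = (\sum_(k <- l') f k) *+ n.-1)%R.
    rewrite /l1; elim: n.-1 => [|m IH] /=; first by rewrite big_nil.
    by rewrite big_cat /= IH GRing.mulrS.
  have bn : ((\sum_(k <- l') b k) *+ n.-1 = - \sum_(k <- l') b k)%R.
    apply/eqP; rewrite -GRing.addr_eq0 -GRing.mulrSr prednK //; apply/eqP.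
    by rewrite additive_of_mulrn Gn.
  have cn : ((\sum_(k <- l') c k) *+ n.-1 = - \sum_(k <- l') c k)%R.
    apply/eqP; rewrite -GRing.addr_eq0 -sum_l1 -big_cat; apply/eqP/bc.
    by rewrite big_cat /= sum_l1 bn GRing.addNr.
  have := bc (l ++ l1); rewrite !big_cat /= !sum_l1 bn cn.
  move=> bc0; split=> E; apply/eqP; rewrite -GRing.subr_eq0; apply/eqP/bc0.
    by rewrite E GRing.subrr.
  by rewrite E GRing.subrr.
have [|rep repP] := @choice G (seq K) (fun y l => P y -> y = (\sum_(k <- l) b k)%R).
  by move=> y; have [/PE[l ->]|] := EM (P y); [exists l|exists [::]].
exists (fun y => \sum_(k <- rep y) c k)%R; split; [split|].
- by move=> y /repP _; apply/QE; exists (rep y).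
- move=> x y /set_mem Px /set_mem Py /bcE.
  by rewrite -!repP.
- move=> z /QE[l ->]; exists (\sum_(k <- l) b k)%R; first by apply/PE; exists l.
  by apply/bcE; rewrite -repP //; apply/PE; exists l.
- move=> x y Px Py.
  rewrite -[RHS]/((\sum_(k <- rep x) c k) + (\sum_(k <- rep y) c k))%R -big_cat.
  apply/bcE; rewrite big_cat /= -!repP //.
  by apply/PE; exists (rep x ++ rep y); rewrite big_cat /= -!repP.
Qed.

(** * Comparison of two bases level by level *)

Lemma card_eq_bij (T : Type) (U : choiceType) (u0 : U) (A : set T) (B : set U) :
  A #= B -> exists f : T -> U, set_bij A B f.
Proof.
pose U' : pointedType := HB.pack (U : Type) U (isPointed.Build U u0).
by move=> AB; have /card_set_bijP[f fAB] : A #= (B : set U') := AB; exists f.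
Qed.

Lemma finite_enum (T : choiceType) (A : set T) : finite_set A ->
  exists s, [/\ uniq s, forall x, x \in s <-> A x & A #= `I_(size s)].
Proof.
move=> Afin; have /finite_setP[b Ab] := Afin.
exists (finmap.enum_fset (fset_set A)); split; first exact: finmap.fset_uniq.
  by move=> x; rewrite (in_fset_set Afin) inE.
by rewrite (card_fset_set Ab).
Qed.

Lemma card_le_uniq (T : choiceType) (A : set T) a :
  (forall s, uniq s -> (forall x, x \in s -> A x) -> (size s <= a)%N) ->
  A #<= `I_a.
Proof.
move=> sA; have [Afin|/(@infinite_set_fset _ _ a.+1)[B BA aB]] := EM (finite_set A).
  have [s [us sE As]] := finite_enum Afin.
  by rewrite (card_le_eql As) card_le_II; apply: sA => // x /sE.
by have := sA (finmap.enum_fset B) (finmap.fset_uniq B) (fun x => BA x); rewrite leqNgt aB.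
Qed.

Section LevelComparison.
Variables (A B1 B2 : groupType) (hB1 : abelian_group B1) (hB2 : abelian_group B2).
Variables (m n p : nat).
Local Notation Z1 := (additive_of hB1).
Local Notation Z2 := (additive_of hB2).
Hypotheses (nilA : nilpotent_group A) (expA : has_exponent A m).
Hypotheses (p_pr : prime p) (p_m : (p %| m)%N) (n_gt0 : (0 < n)%N).
Hypotheses (Z1n : forall x : Z1, (x *+ n = 0)%R) (Z2n : forall x : Z2, (x *+ n = 0)%R).
Hypothesis laws : forall w, satisfies (wreath A B1) w -> satisfies (wreath A B2) w.

(** Suppose that [X2] has more elements of level [e] than [X1].  With the levels
    above [e] in common, and one more element of level [e] than there are in
    [X1], the bound on the number of nontrivial differences along [p^(e-1)]-th
    multiples is larger for [B2] than it is for [B1]; hence some law of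
    [A Wr B1] fails in [A Wr B2]. *)
Lemma level_card_le (X1 : set Z1) (X2 : set Z2) e :
  basis_of p X1 -> basis_of p X2 -> (0 < e)%N ->
  (exists2 x, X1 x & (e <= exponent_of p x)%N) ->
  (forall f, (e < f)%N ->
     finite_set (level p X1 f) /\ level p X1 f #= level p X2 f) ->
  finite_set (level p X1 e) ->
  level p X2 e #<= level p X1 e.
Proof.
move=> bX1 bX2 e_gt0 [x0 Xx0 ex0] above fin_e.
have [XP1 [X10 Xind1] Xgen1] := bX1; have [XP2 [X20 Xind2] Xgen2] := bX2.
pose j := e.-1; have jE : e = j.+1 by rewrite prednK.
have [r1 [ur1 r1E r1card]] := finite_enum fin_e.
rewrite (card_le_eqr r1card); apply: card_le_uniq => r2 ur2 r2X.
rewrite leqNgt; apply/negP => lt_r.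
have fin_above : finite_set [set x | X1 x /\ (e < exponent_of p x)%N].
  apply: (@sub_finite_set _ _ (\bigcup_(f in [set f | (e < f <= logn p n)%N]) level p X1 f)).
    move=> x [Xx ex]; exists (exponent_of p x) => //=.
    by rewrite ex (exponent_of_le n_gt0 Z1n p_pr (XP1 x Xx)).
  apply: bigcup_finite => [|f /andP[/above[]] //].
  apply: (sub_finite_set _ (finite_II (logn p n).+1)).
  by move=> f /= /andP[_]; rewrite ltnS.
have [t [ut tE _]] := finite_enum fin_above.
have [phi phiP] : {phi : nat -> Z1 -> Z2 & forall f, (e < f)%N ->
    set_bij (level p X1 f) (level p X2 f) (phi f)}.
  apply: (@choice nat (Z1 -> Z2) (fun f phi => (e < f)%N ->
    set_bij (level p X1 f) (level p X2 f) phi)) => f.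
  have [ef|_] := ltnP e f; last by exists (fun=> 0%R).
  by have [_ /(card_eq_bij (0%R : Z2))[g gP]] := above f ef; exists g.
pose rho x := phi (exponent_of p x) x.
have rhoP x : x \in t -> X2 (rho x) /\ exponent_of p (rho x) = exponent_of p x.
  move=> /tE[Xx ex]; have [homo _ _] := phiP _ ex.
  exact: (homo x (conj Xx erefl)).
pose s1 := t ++ r1; pose s2 := [seq rho x | x <- t] ++ r2.
have s1E x : x \in s1 <-> X1 x /\ (e <= exponent_of p x)%N.
  rewrite mem_cat; split=> [/orP[/tE[Xx /ltnW] //|/r1E[Xx ->]] //|[Xx]].
  rewrite leq_eqVlt => /predU1P[ex|ex]; apply/orP; [right; apply/r1E|left; apply/tE].
    by split.
  by split.
have s2X x : x \in s2 -> X2 x /\ (e <= exponent_of p x)%N.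
  rewrite mem_cat => /orP[/mapP[y yt ->]|/r2X[Xx ->]] //.
  by have [Xy ->] := rhoP y yt; have /tE[_ /ltnW] := yt.
have us2 : uniq s2.
  rewrite cat_uniq ur2 andbT; apply/andP; split.
    rewrite map_inj_in_uniq // => x y xt yt rxy.
    have [_ ex] := rhoP x xt; have [_ ey] := rhoP y yt.
    have exy : exponent_of p x = exponent_of p y by rewrite -ex rxy ey.
    have /tE[Xx ltx] := xt; have /tE[Xy lty] := yt.
    have [_ inj _] := phiP _ ltx.
    by apply: inj; rewrite ?inE //; move: rxy; rewrite /rho exy.
  apply/hasPn => x /r2X[_ ex]; apply/mapP => -[y yt xE].
  have [_ ey] := rhoP y yt; have /tE[_] := yt.
  by rewrite -ey -xE ex ltnn.
have size_s2 : (1 < size s2)%N.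
  have : (0 < size s1)%N.
    have /s1E : X1 x0 /\ (e <= exponent_of p x0)%N by [].
    by case: s1 {s1E}.
  rewrite /s1 /s2 !size_cat size_map => s1_gt0.
  by apply: leq_ltn_trans s1_gt0 _; rewrite ltn_add2l.
(* [s2] has one element more than [s1], which contains [x0] *)
have [b [b' [bs b's bb']]] : exists b b', [/\ b \in s2, b' \in s2 & b <> b'].
  case: s2 us2 size_s2 {s2X} => [|b [|b' s2]] //= /andP[].
  rewrite inE negb_or => /andP[/eqP bb' _] _ _.
  by exists b, b'; rewrite !inE !eqxx ?orbT.
pose d := (n`_p^')%N.
have nE : n = (d * p ^ logn p n)%N by rewrite mulnC -p_part partnC.
have pd : coprime p d.
  by rewrite -(expn1 p) (pnat_coprime (pi := p)) ?part_pnat ?pnatX ?pnat_id.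
have gens y : gen_by (fun x : Z1 => x *+ p ^ j)%R s1 (y *+ (d * p ^ j))%R.
  have [|l lX yE] := Xgen1 (y *+ d)%R.
    by exists (logn p n); rewrite -GRing.mulrnA -nE Z1n.
  exists [seq x <- l | (j < exponent_of p x)%N].
    move=> x; rewrite mem_filter => /andP[jx xl]; apply/s1E; rewrite jE.
    by split=> //; apply: lX.
  rewrite GRing.mulrnA yE -GRing.sumrMnl big_filter [RHS]big_mkcond /=.
  rewrite [LHS]big_seq [RHS]big_seq; apply: eq_bigr => x /lX Xx.
  case: ltnP => // xj; have [xe _] := exponent_ofP (XP1 x Xx).
  by rewrite -(subnKC xj) expnD GRing.mulrnA xe GRing.mul0rn.
have torsion1 x : x \in s1 -> (x *+ p ^ j *+ p ^ (exponent_of p x - j) = 0)%R.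
  move=> /s1E[Xx ex]; rewrite -GRing.mulrnA -expnD subnKC.
    by have [] := exponent_ofP (XP1 x Xx).
  by rewrite ltnW // -jE.
have indep2 i t' : uniq (i :: t') -> {subset i :: t' <= s2} ->
    forall c, (0 < c < p ^ exponent_of p i)%N -> ~ nspan [set` t'] (i *+ c)%R.
  move=> /= /andP[it ut'] its c /andP[c_gt0 c_lt] /(nspanN n_gt0 Z2n).
  move=> /nspan_coef[s [a [us st sE]]].
  have is2 : i \in s2 by apply: its; rewrite inE eqxx.
  have [Xi _] := s2X i is2.
  have i_s : i \notin s by apply: contra it => /st.
  have ic0 : (i *+ c = 0)%R.
    have := Xind2 (i :: s) _ _ (fun x => if x == i then c else a x) _ i.
    rewrite /= eqxx inE eqxx; apply=> //.
    - by rewrite i_s.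
    - move=> x; rewrite inE => /predU1P[->//|/st xt].
      by have [] := s2X x (its x _); rewrite ?inE ?xt ?orbT.
    - rewrite big_cons eqxx (eq_big_seq (fun x => x *+ a x)%R) => [|x xs].
        by rewrite -sE GRing.subrr.
      by case: eqP => // xi; rewrite xi (negPf i_s) in xs.
  have := (exponent_of_dvd p_pr c (XP2 i Xi)).1 ic0.
  by move=> /(dvdn_leq c_gt0); rewrite leqNgt c_lt.
have neq0 x : x \in s2 -> x <> 0%R.
  by move=> /s2X[Xx _]; apply: (basis_neq0 bX2).
have spS i (s : seq Z2) (x : Z2) c :
    nspan [set` s] x -> nspan [set` i :: s] (x + i *+ c)%R.
  move=> sx; apply: nspanD.
    by apply: sub_nspan sx => y /= ys; rewrite inE ys orbT.
  by apply/nspanMn/nspan1; rewrite /= inE eqxx.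
have lt_e x : x \in s2 -> (j < exponent_of p x)%N.
  by move=> /s2X[_]; rewrite jE.
have p1_gt0 : (0 < p - 1)%N by rewrite subn_gt0 prime_gt1.
have sum_const (r : seq Z1) (r' : seq Z2) :
    (forall x, x \in r -> exponent_of p x = e) ->
    (forall x, x \in r' -> exponent_of p x = e) -> (size r < size r')%N ->
    (\sum_(x <- r) (p ^ (exponent_of p x - j) - 1) <
     \sum_(x <- r') (p ^ (exponent_of p x - j) - 1))%N.
  move=> re r'e lt_rr'; rewrite (eq_big_seq (fun=> p - 1)%N); last first.
    by move=> x /re ->; rewrite jE subSnn expn1.
  rewrite [X in (_ < X)%N](eq_big_seq (fun=> p - 1)%N); last first.
    by move=> x /r'e ->; rewrite jE subSnn expn1.
  by rewrite !big_const_seq !iter_addn_0 !count_predT ltn_pmul2l.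
have lt_sum : (\sum_(x <- s1) (p ^ (exponent_of p x - j) - 1) <
    \sum_(x <- s2) (p ^ (exponent_of p x - j) - 1))%N.
  rewrite /s1 /s2 !big_cat /= big_map (eq_big_seq (fun x : Z1 =>
    p ^ (exponent_of p (rho x) - j) - 1)%N) => [|x xt]; last first.
    by have [_ ->] := rhoP x xt.
  rewrite ltn_add2l; apply: sum_const => // [x /r1E[] //|x /r2X[] //].
have [w [w1 w2]] := wreath_law_separates (k := id) nilA expA p_pr p_m pd
  torsion1 gens (fun s => nspan0 _)
  (fun s x y => @nspanB Z2 n n_gt0 Z2n [set` s] x y) spS indep2 us2 lt_e
  (fun x xs => (exponent_ofP (XP2 x (s2X x xs).1)).1)
  (neq0 b bs) (neq0 b' b's) bb' lt_sum.
by apply: w2; apply: laws.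
Qed.

End LevelComparison.

(** * From bases to decompositions into cyclic groups *)

Lemma finite_inj_image (T U : Type) (f : T -> U) (A : set T) :
  {in A &, injective f} -> finite_set (f @` A) -> finite_set A.
Proof. by move=> /inj_card_eq /eq_finite_set ->. Qed.

Section CyclicPowers.
Variables (q : nat) (M : Type).
Local Notation C := (cyclic_pow q M).

Lemma finite_cyclic_pow : finite_set [set: M] -> finite_set [set: C].
Proof.
move=> Mfin; pose M' : choiceType := {classic M}.
have [s [_ sE _]] := @finite_enum M' [set: M'] Mfin.
pose F (f : C) : {ffun 'I_(size s) -> 'I_q.-1.+1} :=
  [ffun i => f (tnth (in_tuple s) i)].
apply: (finite_inj_image (f := F)); last exact: finite_finset.
move=> f g _ _ /ffunP fg; apply/val_inj/functional_extensionality_dep => x.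
have /sE/seq_tnthP[i ->] : [set: M'] x by [].
by have := fg i; rewrite !ffunE.
Qed.

Fact cyclic_single_subproof (x : M) :
  `[< finite_set [set y | (if `[< y = x >] then inZp 1 else 1 : cyclic q) <> 1] >].
Proof.
apply/asboolP; apply: sub_finite_set (finite_set1 x) => y /=.
by case: asboolP.
Qed.

Definition cyclic_single (x : M) : C := DirProd (cyclic_single_subproof x).

Lemma infinite_cyclic_pow : (1 < q)%N -> infinite_set [set: M] ->
  infinite_set [set: C].
Proof.
move=> q_gt1 Minf Cfin; apply: Minf.
apply: (finite_inj_image (f := cyclic_single)); last exact: sub_finite_set Cfin.
move=> x y _ _ /(congr1 (fun f : C => f x)) /=.
rewrite asboolT //; case: asboolP => // _ /(congr1 val) /=.
by rewrite modn_small // prednK // ltnW.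
Qed.

Lemma infinite_cyclic_pow_index : infinite_set [set: C] -> infinite_set [set: M].
Proof. by move=> + /finite_cyclic_pow. Qed.

End CyclicPowers.

Section Decomposition.
Variables (B : groupType) (hB : abelian_group B) (n p : nat).
Local Notation Z := (additive_of hB).
Hypotheses (n_gt0 : (0 < n)%N) (Bn : forall x : B, x ^+ n = 1) (p_pr : prime p).
Variable X : set Z.
Hypothesis bX : basis_of p X.

Let Zn (x : Z) : (x *+ n = 0)%R.
Proof. by rewrite additive_of_mulrn Bn. Qed.

Lemma basis_elements_span : forall y, primary B p y <->
  exists l : seq X, y = (\sum_(k <- l) (\val k : Z))%R.
Proof.
have [XP _ Xgen] := bX; move=> y; split=> [[k yk]|[l ->]].
  have [|l lX ->] := Xgen (y : Z).
    by exists k; rewrite additive_of_mulrn.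
  elim: l lX => [|x l IH] lX; first by exists [::]; rewrite !big_nil.
  have [|l' l'E] := IH; first by move=> z zl; apply: lX; rewrite inE zl orbT.
  have Xx : x \in X by rewrite inE; apply: lX; rewrite inE eqxx.
  by exists ((exist _ x Xx : X) :: l'); rewrite !big_cons l'E.
exists (logn p n).
suff : ((\sum_(k <- l) (\val k : Z)) *+ p ^ logn p n = 0 :> Z)%R.
  by rewrite additive_of_mulrn.
rewrite -GRing.sumrMnl; apply: big1 => k _; apply/(exponent_of_dvd p_pr).
  by apply: XP; apply: set_valP.
by rewrite dvdn_exp2l // (exponent_of_le n_gt0 Zn p_pr) //; apply/XP/set_valP.
Qed.

Definition level_list : seq nat :=
  [seq e <- rev (iota 1 (logn p n)) | `[< level p X e !=set0 >]].

Lemma level_list_lt i j : (i < j < size level_list)%N ->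
  (nth 0%N level_list j < nth 0%N level_list i)%N.
Proof.
move=> /andP[ij js].
have gtn_trans : transitive gtn by move=> a b c /= ba cb; apply: ltn_trans cb ba.
have sorted_l : sorted gtn level_list.
  by apply: (sorted_filter gtn_trans); rewrite rev_sorted; apply: iota_ltn_sorted.
have := sorted_ltn_nth gtn_trans 0%N sorted_l i j; rewrite !inE; apply=> //.
exact: ltn_trans js.
Qed.

Lemma mem_level_list e : e \in level_list <-> level p X e !=set0.
Proof.
rewrite mem_filter mem_rev mem_iota; split=> [/andP[/asboolP //]|Xe].
have [x [Xx ex]] := Xe; have [XP _ _] := bX.
apply/andP; split; first exact/asboolP.
rewrite -{1}ex (exponent_of_gt0 (XP x Xx) (basis_neq0 bX Xx)) add1n ltnS -ex.
exact: (exponent_of_le n_gt0 Zn p_pr (XP x Xx)).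
Qed.

Let r := size level_list.
Let u i := nth 0%N level_list i.
Let M i : Type := level p X (u i).
Let D := dirprod (fun i : 'I_r => cyclic_pow (p ^ u i) (M i)).

Let D_abel : abelian_group D.
Proof.
move=> f g; apply/val_inj/functional_extensionality_dep => i.
apply/val_inj/functional_extensionality_dep => x /=.
by apply/val_inj; rewrite /= addnC.
Qed.

Fact basis_vector_subproof1 (k : X) (i : 'I_r) :
  `[< finite_set [set m : M i |
        (if \val m == \val k then inZp 1 else 1 : cyclic (p ^ u i)) <> 1] >].
Proof.
apply/asboolP; apply: (finite_inj_image (f := fun m : M i => \val m)).
  by move=> m m' _ _ /val_inj.
apply: sub_finite_set (finite_set1 (\val k)) => _ [m /= + <-].
by case: eqP.
Qed.

Fact basis_vector_subproof2 (k : X) :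
  `[< finite_set [set i : 'I_r | DirProd (basis_vector_subproof1 k i) <> 1] >].
Proof. by apply/asboolP; apply: finite_finset. Qed.

Let basis_vector (k : X) : D := DirProd (basis_vector_subproof2 k).

Let basis_vector_sum (l : seq X) (i : 'I_r) (m : M i) :
  ((\sum_(k <- l) (basis_vector k : additive_of D_abel))%R : D) i m =
  inZp (count (fun k : X => \val m == \val k) l) :> 'I_(p ^ u i).-1.+1.
Proof.
elim: l => [|k l IH]; first by rewrite big_nil; apply/val_inj; rewrite /= mod0n.
rewrite big_cons -[LHS]/((basis_vector k : D) i m * _) IH /=.
apply/val_inj => /=; case: eqP => _ /=; last by rewrite modn_mod.
by rewrite modnDm.
Qed.

(* As the orders decrease strictly, a basis element occurs in one factor only. *)
Let index_inj (i i' : 'I_r) (m : M i) (m' : M i') : \val m = \val m' -> i = i'.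
Proof.
move=> mm'; have [_ em] := set_valP m; have [_ em'] := set_valP m'.
have uu' : u i = u i' by rewrite -em -em' mm'.
apply: val_inj; apply/eqP; rewrite eqn_leq leqNgt [X in _ && X]leqNgt.
have ltu (j j' : 'I_r) : (j < j')%N -> u j <> u j'.
  move=> jj' ujj'; have := @level_list_lt j j'.
  by rewrite jj' ltn_ord -/(u j) -/(u j') ujj' ltnn => /(_ isT).
by apply/andP; split; apply/negP => /ltu; rewrite uu'.
Qed.

Let X_index (k : X) : exists (i : 'I_r) (m : M i), \val m = \val k.
Proof.
have Xk : X (\val k) by apply: set_valP.
have /(nthP 0%N)[i ir ui] : exponent_of p (\val k) \in level_list.
  by apply/mem_level_list; exists (\val k).
have mk : \val k \in level p X (u i) by rewrite inE.
by exists (Ordinal ir), (exist _ (\val k) mk).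
Qed.

Let level_X (i : 'I_r) (m : M i) : exists k : X, \val k = \val m.
Proof.
have [Xm _] := set_valP m; have mX : \val m \in X by rewrite inE.
by exists (exist _ (\val m) mX).
Qed.

Let count_val (i : 'I_r) (m : M i) (k : X) (l : seq X) : \val k = \val m ->
  count (fun k : X => \val m == \val k) l = count_mem k l.
Proof. by move=> <-; apply: eq_count => k' /=; rewrite (inj_eq val_inj) eq_sym. Qed.

Let basis_vector_gen (f : D) :
  exists l, f = (\sum_(k <- l) (basis_vector k : additive_of D_abel))%R.
Proof.
pose fn (i : 'I_r) (m : M i) : nat := (f i m : 'I_(p ^ u i).-1.+1).
pose cof_spec (k : X) := [set a | exists (i : 'I_r) (m : M i),
  \val m = \val k /\ a = fn i m].
pose cof (k : X) := xget 0%N (cof_spec k).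
have cofE (i : 'I_r) (m : M i) (k : X) : \val k = \val m -> cof k = fn i m.
  move=> km; have [i' [m' [mk' ->]]] : cof_spec k (cof k).
    by apply: xgetPex; exists (fn i m), i, m.
  have ii' : i' = i by apply: (index_inj (m := m') (m' := m)); rewrite mk'.
  subst i'; have -> // : m' = m by apply: val_inj; rewrite mk'.
have supp_fin : finite_set [set k | cof k <> 0%N].
  apply: (finite_inj_image (f := fun k : X => \val k)).
    by move=> k k' _ _ /val_inj.
  apply: (@sub_finite_set _ _ (\bigcup_(i in [set: 'I_r])
      [set \val m | m in [set m : M i | f i m <> 1]])).
    move=> _ [k ck <-]; have [i [m mk]] := X_index k.
    exists i => //; exists m => //= fim; apply: ck.
    by rewrite (cofE i m) // /fn fim.
  apply: bigcup_finite => [|i _]; first exact: finite_finset.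
  apply: finite_image; exact: asboolW (dp_finite (f i)).
have [s [us sE _]] := finite_enum supp_fin.
pose l := flatten [seq nseq (cof k) k | k <- s].
have count_l k : count_mem k l = cof k.
  rewrite count_flatten -map_comp sumnE big_map.
  under eq_bigr do rewrite /= count_nseq.
  have [ks|ks] := boolP (k \in s).
    rewrite (bigD1_seq k) //= eqxx mul1n big1 ?addn0 // => k' /negPf.
    by rewrite eq_sym eq_sym => ->.
  rewrite big1_seq.
    by symmetry; apply: contrapT => /sE; apply/negP.
  move=> k' /andP[_ ks'] /=; case: (k' =P k) => // kk'.
  by rewrite -kk' ks' in ks.
exists l; apply/val_inj/functional_extensionality_dep => i.
apply/val_inj/functional_extensionality_dep => m /=.
have [k km] := level_X m.
apply/val_inj; rewrite basis_vector_sum (count_val _ km) count_l (cofE i m) //=.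
by rewrite modn_small //; apply: ltn_ord.
Qed.

Lemma basis_decomposition : primary_decomposition B p r u M.
Proof.
have [XP _ _] := bX.
split.
- by move=> i j ijr; apply: level_list_lt.
- move=> i ir; have /mem_level_list[x [Xx ex]] := mem_nth 0%N ir.
  by rewrite /u -ex; apply: exponent_of_gt0 (XP x Xx) (basis_neq0 bX Xx).
- move=> i ir; have /mem_level_list[x Xx] := mem_nth 0%N ir.
  have xM : x \in level p X (u i) by rewrite inE.
  by exists (exist _ x xM).
have D_gen f : [set: D] f <->
    exists l, f = (\sum_(k <- l) (basis_vector k : additive_of D_abel))%R.
  by split=> // _; apply: basis_vector_gen.
apply: (@gen_isog B D hB D_abel n X (fun k => \val k) basis_vector) => //.
  exact: basis_elements_span.
move=> l; rewrite (basis_relation p_pr l bX val_inj) => [|k]; last exact: set_valP.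
split=> [dvd_l|sum0 k].
  apply/val_inj/functional_extensionality_dep => i.
  apply/val_inj/functional_extensionality_dep => m /=.
  have [k km] := level_X m; have [_ em] := set_valP m.
  rewrite basis_vector_sum (count_val _ km); apply/val_inj => /=.
  have := dvd_l k; rewrite km em => /eqP.
  by rewrite prednK // expn_gt0 prime_gt0.
have [i [m mk]] := X_index k; have [_ em] := set_valP m.
have := congr1 (fun f : D => val (f i m)) sum0 => /=.
rewrite basis_vector_sum (count_val _ (esym mk)) /= prednK ?expn_gt0 ?prime_gt0 //.
by rewrite -mk em => /eqP.
Qed.

End Decomposition.

(** * Embedding finitely generated subgroups *)

Lemma card_le_inj (T : Type) (U : choiceType) (u0 : U) (A : set T) :
  A #<= [set: U] -> exists f : T -> U, {in A &, injective f}.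
Proof.
pose U' : pointedType := HB.pack (U : Type) U (isPointed.Build U u0).
by move=> AU; have /pcard_injP[f fA] : A #<= [set: U'] := AU; exists f.
Qed.

Section CyclicSumEmbedding.
Variables (p r s k : nat) (u v : nat -> nat) (M N : nat -> Type).
Local Notation D1 := (dirprod (fun i : 'I_r => cyclic_pow (p ^ u i) (M i))).
Local Notation D2 := (dirprod (fun i : 'I_s => cyclic_pow (p ^ v i) (N i))).
Local Notation K1 := {i : 'I_r & M i}.
Hypotheses (p_pr : prime p) (kr : (k < r)%N) (ks : (k < s)%N).
Hypotheses (u_dec : forall i j, (i < j < r)%N -> (u j < u i)%N)
  (N_neq0 : forall i, (i < s)%N -> [set: N i] !=set0)
  (uv : forall i, (i <= k)%N -> u i = v i)
  (MN : forall i, (i < k)%N -> [set: M i] #= [set: N i])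
  (Nk_inf : infinite_set [set: N k]).

Let coordinate (f : D1) (x : K1) : nat :=
  (f (projT1 x) (projT2 x) : 'I_(p ^ u (projT1 x)).-1.+1).

Definition dp_support (f : D1) : set K1 := [set x | coordinate f x <> 0%N].

Lemma finite_dp_support f : finite_set (dp_support f).
Proof.
apply: (@sub_finite_set _ _ (\bigcup_(i in [set: 'I_r])
    [set existT (fun i : 'I_r => M i) i m | m in [set m : M i | f i m <> 1]])).
  move=> [i m] fim; exists i => //; exists m => //= fim1; apply: fim.
  by rewrite /coordinate /= fim1.
apply: bigcup_finite => [|i _]; first exact: finite_finset.
apply: finite_image; exact: asboolW (dp_finite (f i)).
Qed.

(** The factors before the [k]-th ones are matched by bijections; all the others
    involved embed into copies of the infinitely many [k]-th factors, whose
    order is at least theirs. *)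
Lemma cyclic_sum_embedding (T : set K1) : finite_set T ->
  exists phi : D1 -> D2, (forall f g, phi (f * g) = phi f * phi g) /\
    forall f, dp_support f `<=` T -> phi f = 1 -> f = 1.
Proof.
move=> Tfin; pose T' : set {classic K1} := [set x | T x /\ (k <= projT1 x)%N].
have [t [_ tE _]] : exists t : seq {classic K1}, [/\ uniq t, forall x, x \in t <-> T' x
    & T' #= `I_(size t)].
  by apply: finite_enum; apply: sub_finite_set Tfin => x [].
have hR i : exists R : M i -> N i -> Prop, (i < k)%N ->
    [/\ forall m, exists n, R m n, forall n, exists m, R m n,
        forall m m' n, R m n -> R m' n -> m = m'
      & forall m n n', R m n -> R m n' -> n = n'].
  have [ik|_] := ltnP i k; last by exists (fun _ _ => True).
  have [n0 _] := N_neq0 (ltn_trans ik ks).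
  have [f [_ f_inj f_surj]] := @card_eq_bij (M i) {classic N i} n0 _ _ (MN ik).
  exists (fun m n => f m = n) => _; split=> [m|n|m m' n <- ff'|m n n' <- <- //].
  - by exists (f m).
  - by have [m _ <-] := f_surj n I; exists m.
  - by apply: f_inj; rewrite ?inE.
have [R RP] := all_sig (fun i => cid (hR i)).
have hnu i : exists nu : nat -> N i -> Prop, i = k ->
    [/\ forall j, exists n, nu j n, forall j j' n, nu j n -> nu j' n -> j = j'
      & forall j n n', nu j n -> nu j n' -> n = n'].
  have [->|ik] := eqVneq i k; last by exists (fun _ _ => True) => ik'; rewrite ik' eqxx in ik.
  have [n0 _] := N_neq0 ks.
  have [f f_inj] := card_le_inj (n0 : {classic N k}) ((infiniteP _).1 Nk_inf).
  exists (fun j n => f j = n) => _; split=> [j|j j' n <- ff'|j n n' <- <- //].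
    by exists (f j).
  by apply: f_inj; rewrite ?inE.
have [nu nuP] := all_sig (fun i => cid (hnu i)).
(* the coordinate of the image at [n] in the [i]-th factor comes from [x] *)
pose rel (i : 'I_s) (n : N i) (x : {classic K1}) :=
  (exists (ik : (i < k)%N) (m : M i),
    x = existT _ (Ordinal (ltn_trans ik kr)) m /\ R i m n) \/
  [/\ i = k :> nat, x \in t & nu i (index x t) n].
have rel_fun i n x x' : @rel i n x -> @rel i n x' -> x = x'.
  move=> [[ik [m [-> mn]]]|[ik xt xn]] [[ik' [m' [-> m'n]]]|[ik' x't x'n]].
  - have [_ _ + _] := RP i ik; move/(_ _ _ _ mn m'n) => ->.
    by rewrite (bool_irrelevance ik ik').
  - by exfalso; have := ik; rewrite ik' ltnn.
  - by exfalso; have := ik'; rewrite ik ltnn.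
  - have [_ + _] := nuP i ik; move/(_ _ _ _ xn x'n) => e.
    by rewrite -(nth_index x xt) e nth_index.
have rel_inj i n n' x : @rel i n x -> @rel i n' x -> n = n'.
  move=> [[ik [m [xE mn]]]|[ik xt xn]] [[ik' [m' [xE' m'n]]]|[ik' x't x'n]].
  - have [_ _ _] := RP i ik; apply; first exact: mn.
    have -> // : m = m'.
    move: xE; rewrite xE' (bool_irrelevance ik' ik) => xE2.
    exact: esym (Eqdep_dec.inj_pair2_eq_dec _ (@eq_comparable _) _ _ _ _ xE2).
  - by exfalso; have := ik; rewrite ik' ltnn.
  - by exfalso; have := ik'; rewrite ik ltnn.
  - by have [_ _] := nuP i ik; apply; [exact: xn|exact: x'n].
have rel_le i n x : @rel i n x -> (u (projT1 x) <= v i)%N.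
  move=> [[ik [m [-> _]]]|[ik /tE[_ kx] _]] /=; first by rewrite uv // ltnW.
  rewrite ik -uv //; move: kx; rewrite leq_eqVlt => /predU1P[<- //|kx].
  by apply/ltnW/u_dec; rewrite kx ltn_ord.
have rel_tot x : T x -> exists (i : 'I_s) (n : N i), rel i n x.
  case: x => -[i ir] m Tx; have [ki|ik] := leqP k i; last first.
    have [+ _ _ _] := RP i ik; move=> /(_ m)[n mn].
    exists (Ordinal (ltn_trans ik ks)), n; left; exists ik, m; split=> //.
    by rewrite (bool_irrelevance ir (ltn_trans ik kr)).
  have [+ _ _] := nuP k erefl.
  move=> /(_ (index (existT _ (Ordinal ir) m : {classic K1}) t))[n xn].
  by exists (Ordinal ks), n; right; split=> //; apply/tE.
have hsrc (i : 'I_s) (n : N i) :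
    exists o : option K1, forall x, o = Some x <-> rel i n x.
  have [[x nx]|nox] := EM (exists x, rel i n x).
    by exists (Some x) => y; split=> [[<-] //|ny]; rewrite (rel_fun i n x y).
  by exists None => y; split=> // ny; case: nox; exists y.
pose src i n := sval (cid (hsrc i n)).
have srcP i n x : src i n = Some x <-> rel i n x by apply: svalP (cid (hsrc i n)) x.
pose val_at (f : D1) (i : 'I_s) (n : N i) : cyclic (p ^ v i) :=
  if src i n is Some x then inZp (p ^ (v i - u (projT1 x)) * coordinate f x) else 1.
have val_at1 f i n x : rel i n x -> val_at f i n = 1 -> coordinate f x = 0%N.
  move=> nx; rewrite /val_at ((srcP i n x).2 nx) => /(congr1 val) /=.
  rewrite prednK ?expn_gt0 ?prime_gt0 // modn_small; last first.
    rewrite -[X in (_ < p ^ X)%N](subnK (rel_le _ _ _ nx)) expnD ltn_pmul2l.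
      apply: leq_trans (ltn_ord _) _.
      by rewrite prednK // expn_gt0 prime_gt0.
    by rewrite expn_gt0 prime_gt0.
  move=> /eqP; rewrite muln_eq0 expn_eq0 eqn0Ngt prime_gt0 //=.
  by move=> /eqP.
have val_at_M f g i n : val_at (f * g) i n = val_at f i n * val_at g i n.
  rewrite /val_at; case E : (src i n) => [x|]; last by rewrite mulg1.
  have ux := rel_le _ _ _ ((srcP i n x).1 E).
  have -> : coordinate (f * g) x =
      ((coordinate f x + coordinate g x) %% p ^ u (projT1 x))%N.
    by rewrite -[X in _ = (_ %% X)%N]prednK // expn_gt0 prime_gt0.
  apply/val_inj => /=; rewrite modnDm -mulnDr prednK ?expn_gt0 ?prime_gt0 //.
  by rewrite muln_modr -expnD subnK // modn_mod.
have fin1 f i : `[< finite_set [set n | val_at f i n <> 1] >].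
  apply/asboolP; apply: (finite_inj_image (f := src i)).
    move=> n n'; rewrite !inE /= /val_at.
    case E : (src i n) => [x|//] _; case E' : (src i n') => [x'|//] _ [xx'].
    by apply: rel_inj ((srcP i n x).1 E) _; rewrite xx'; apply/srcP.
  apply: (sub_finite_set _ (finite_image Some (finite_dp_support f))).
  move=> _ [n + <-]; rewrite /= /val_at; case: (src i n) => [x|//] nx.
  by exists x => //= fx; apply: nx; rewrite fx muln0; apply/val_inj; rewrite /= mod0n.
have fin2 f : `[< finite_set [set i | DirProd (fin1 f i) <> 1] >].
  by apply/asboolP; apply: finite_finset.
exists (fun f => DirProd (fin2 f)); split=> [f g|f fT f1].
  apply/val_inj/functional_extensionality_dep => i.
  by apply/val_inj/functional_extensionality_dep => n; apply: val_at_M.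
apply/val_inj/functional_extensionality_dep => i.
apply/val_inj/functional_extensionality_dep => m; apply/val_inj.
rewrite -[LHS]/(coordinate f (existT _ i m)).
apply: contrapT => fim; have [i' [n nx]] := rel_tot _ (fT _ fim).
apply/fim/(val_at1 _ _ _ _ nx).
by have := congr1 (fun g : D2 => g i' n) f1.
Qed.

End CyclicSumEmbedding.

Lemma primary_subgroup (B : groupType) p : abelian_group B ->
  subgroup (primary B p).
Proof.
move=> hB; split=> [|x y [a xa] [b yb]]; first by exists 0%N.
exists (a + b)%N; have xy : commute x y^-1 by apply: hB.
rewrite expgMn // expVgn expnD expgnA xa expg1n mulnC expgnA yb expg1n.
by rewrite invg1 mulg1.
Qed.

Lemma subgroupM (G : groupType) (H : set G) : subgroup H ->
  forall x y, H x -> H y -> H (x * y).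
Proof.
move=> [H1 HV] x y Hx Hy; rewrite -[y]invgK; apply: (HV) => //.
by rewrite -div1g; apply: HV.
Qed.

Lemma subgroupV (G : groupType) (H : set G) : subgroup H ->
  forall x, H x -> H x^-1.
Proof. by move=> [H1 HV] x Hx; rewrite -div1g; apply: HV. Qed.

Lemma eval_in_subgroup (G : groupType) (H : set G) (e : nat -> G) w :
  subgroup H -> (forall i, H (e i)) -> H (eval e w).
Proof.
move=> sH He; elim: w => [i||w1 IH1 w2 IH2|w IH] //=; first by case: sH.
  exact: subgroupM.
exact: subgroupV.
Qed.

(** In the finite case the given isomorphism serves for [psi].  In the infinite
    case it is a homomorphism of the whole component that is injective on the
    elements supported in a finite set of factors, chosen to contain the
    supports of [l]. *)
Lemma primary_embedding p (B1 B2 : groupType) :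
  abelian_group B1 -> abelian_group B2 -> prime p -> primary_equiv p B1 B2 ->
  forall l : seq B1, (forall x, x \in l -> primary B1 p x) ->
  exists (psi : B1 -> B2) (H : set B1),
    [/\ forall x y, primary B1 p x -> primary B1 p y -> psi (x * y) = psi x * psi y,
        subgroup H, forall x, x \in l -> H x, H `<=` primary B1 p
      & forall x, H x -> psi x = 1 -> x = 1] /\
    forall x, primary B1 p x -> primary B2 p (psi x).
Proof.
move=> hB1 hB2 p_pr equiv l lP.
have sP1 := primary_subgroup p hB1; have sP2 := primary_subgroup p hB2.
have P1_1 : primary B1 p 1 by case: sP1.
have hom1 (G : groupType) (f : B1 -> G) : (forall x y, primary B1 p x ->
    primary B1 p y -> f (x * y) = f x * f y) -> f 1 = 1.
  by move=> fM; apply: (@mulgI _ (f 1)); rewrite -fM // !mulg1.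
case: equiv => [[_ _ [f [[f_homo f_inj _] fM]]]|].
  exists f, (primary B1 p); split=> //; split=> // x Px fx1.
  by apply: f_inj; rewrite ?inE // fx1 hom1.
move=> [_ _ [r [s [u [v [M [N [pd1 pd2 [k [[kr ks] below fi1 fi2 ukv]]]]]]]]]].
have [u_dec _ _ [f1 [[_ f1_inj _] f1M]]] := pd1.
have [_ _ N_neq0 [f2 [[_ f2_inj f2_surj] f2M]]] := pd2.
have Nk_inf : infinite_set [set: N k].
  by have [Ninf _] := fi2; apply: infinite_cyclic_pow_index Ninf.
have uv i : (i <= k)%N -> u i = v i.
  by rewrite leq_eqVlt => /predU1P[->|/below[]].
have MN i : (i < k)%N -> [set: M i] #= [set: N i] by move=> /below[].
pose T : set {i : 'I_r & M i} :=
  \bigcup_(x in [set` l]) dp_support (f1 x).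
have Tfin : finite_set T.
  by apply: bigcup_finite => [|x _]; [apply: finite_seq|apply: finite_dp_support].
have [phi [phiM phi_inj]] := cyclic_sum_embedding p_pr kr ks u_dec N_neq0 uv MN Nk_inf Tfin.
have [|g gP] := @choice (dirprod (fun i : 'I_s => cyclic_pow (p ^ v i) (N i))) B2
    (fun d x => primary B2 p x /\ f2 x = d).
  by move=> d; have [x Px xd] := f2_surj d I; exists x.
have gM d d' : g (d * d') = g d * g d'.
  have [Pd fd] := gP d; have [Pd' fd'] := gP d'; have [Pdd' fdd'] := gP (d * d').
  apply: f2_inj; rewrite ?inE //; first exact: (subgroupM sP2).
  by rewrite fdd' f2M // fd fd'.
have f1_1 := hom1 _ _ f1M.
have f1V x : primary B1 p x -> f1 x^-1 = (f1 x)^-1.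
  move=> Px; apply: (@mulgI _ (f1 x)).
  by rewrite -f1M //; [rewrite !mulgV f1_1|apply: (subgroupV sP1)].
have supp1 : dp_support (1 : dirprod (fun i : 'I_r => cyclic_pow (p ^ u i) (M i))) `<=` T.
  by move=> x; rewrite /dp_support /=.
have suppV f : dp_support f `<=` T ->
  dp_support (f^-1 : dirprod (fun i : 'I_r => cyclic_pow (p ^ u i) (M i))) `<=` T.
  move=> fT x fx; apply: fT => /= f0; apply: fx => /=.
  by rewrite f0 subn0 modnn.
have suppM f f' : dp_support f `<=` T -> dp_support f' `<=` T ->
  dp_support (f * f' : dirprod (fun i : 'I_r => cyclic_pow (p ^ u i) (M i))) `<=` T.
  move=> fT f'T x fx; apply: contrapT => nx.
  have f0 : ~ dp_support f x by move=> /fT.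
  have f'0 : ~ dp_support f' x by move=> /f'T.
  move: f0 f'0 => /contrapT f0 /contrapT f'0.
  by apply: fx => /=; rewrite f0 f'0 mod0n.
exists (g \o phi \o f1), [set x | primary B1 p x /\ dp_support (f1 x) `<=` T].
split; last by move=> x Px /=; have [] := gP (phi (f1 x)).
split=> [x y Px Py||x xl|x [] //|x [Px xT] /= gx].
- by rewrite /= f1M // phiM gM.
- split=> [|x y [Px xT] [Py yT]]; first by split=> //; rewrite f1_1.
  split; first by case: sP1 => _; apply.
  rewrite f1M ?f1V //; last exact: (subgroupV sP1).
  by apply: suppM => //; apply: suppV.
- by split; [apply: lP|move=> c cx; exists x].
have g1 : g 1 = 1 by apply: (@mulgI _ (g 1)); rewrite -gM !mulg1.
have phi1 : phi (f1 x) = 1.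
  by rewrite -(gP (phi (f1 x))).2 gx -g1 (gP 1).2.
by apply: f1_inj; rewrite ?inE // f1_1; apply: phi_inj.
Qed.

(** The element [x ^+ n`_p^'] lies in the [p]-primary component, and [x] is trivial if
    all of these are.  So the homomorphisms of the primary components combine
    to one of [B1] that is injective on the subgroup generated by the [b i]. *)
Lemma local_embedding n (B1 B2 : groupType) :
  abelian_group B1 -> abelian_group B2 -> (0 < n)%N ->
  (forall x : B1, x ^+ n = 1) -> (forall x : B2, x ^+ n = 1) ->
  (forall p, prime p -> (p %| n)%N -> primary_equiv p B1 B2) ->
  forall N (b : nat -> B1), (forall i, (N <= i)%N -> b i = 1) ->
  exists b' : nat -> B2, forall w, eval b w = 1 <-> eval b' w = 1.
Proof.
move=> hB1 hB2 n_gt0 B1n B2n equiv N b bN.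
have primary_part p (B : groupType) (x : B) : (forall x : B, x ^+ n = 1) ->
    primary B p (x ^+ n`_p^').
  by move=> Bn; exists (logn p n); rewrite -p_part -expgnA mulnC partnC.
have exp_primary p (B : groupType) (hB : abelian_group B) (x : B) : prime p ->
    (forall x : B, x ^+ n = 1) -> primary B p x -> x ^+ n`_p = 1.
  move=> p_pr Bn [k xk]; rewrite p_part -(additive_of_mulrn (x : additive_of hB)).
  have Zn (z : additive_of hB) : (z *+ n = 0)%R by rewrite additive_of_mulrn Bn.
  have xP : exists k, ((x : additive_of hB) *+ p ^ k = 0)%R.
    by exists k; rewrite additive_of_mulrn.
  by apply/(exponent_of_dvd p_pr _ xP)/dvdn_exp2l/(exponent_of_le n_gt0 Zn p_pr).
pose l p := [seq b i ^+ n`_p^' | i <- iota 0 N].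
have h p : exists psiH : (B1 -> B2) * set B1, p \in primes n ->
    [/\ forall x y, primary B1 p x -> primary B1 p y ->
          psiH.1 (x * y) = psiH.1 x * psiH.1 y,
        subgroup psiH.2, forall x, x \in l p -> psiH.2 x,
        psiH.2 `<=` primary B1 p
      & forall x, psiH.2 x -> psiH.1 x = 1 -> x = 1] /\
    forall x, primary B1 p x -> primary B2 p (psiH.1 x).
  have [|np] := boolP (p \in primes n); last by exists (fun=> 1, set0).
  rewrite mem_primes => /and3P[p_pr _ p_n].
  have [|psi [H psiH]] := primary_embedding hB1 hB2 p_pr (equiv p p_pr p_n) (l := l p).
    by move=> _ /mapP[i _ ->]; apply: primary_part.
  by exists (psi, H).
have [psiH psiHP] := all_sig (fun p => cid (h p)).
pose part p (y : B1) : additive_of hB2 := (psiH p).1 (y ^+ n`_p^').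
pose psi (y : B1) : B2 := (\sum_(p <- primes n) part p y)%R.
have psiM x y : psi (x * y) = psi x * psi y.
  rewrite -[RHS]/((\sum_(p <- primes n) part p x) + (\sum_(p <- primes n) part p y))%R.
  rewrite -big_split /=; apply: eq_big_seq => p p_n.
  have [[partM _ _ _ _] _] := psiHP p p_n.
  rewrite /part expgMn; last exact: hB1.
  by apply: partM; apply: primary_part.
have psi1 : psi 1 = 1 by apply: (@mulgI _ (psi 1)); rewrite -psiM !mulg1.
exists (psi \o b) => w; rewrite -eval_morph //; split=> [->//|].
set y := eval b w => psi_y.
have y_part p : p \in primes n -> y ^+ n`_p^' = 1.
  move=> p_n; have [[_ sH lH HP psi_inj] psi_primary] := psiHP p p_n.
  have p_pr : prime p by move: p_n; rewrite mem_primes => /andP[].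
  apply: psi_inj.
    rewrite -/(_ y) (eval_morph (f := fun x => x ^+ n`_p^')); last first.
      by move=> x z; apply: expgMn; apply: hB1.
    apply: eval_in_subgroup => // i /=.
    have [iN|Ni] := ltnP i N; first by apply/lH/map_f; rewrite mem_iota.
    by rewrite bN // expg1n; case: sH.
  have := psi_primary _ (primary_part p B1 y B1n).
  set z := (psiH p).1 _ => zP.
  have z1 : ((z : additive_of hB2) *+ n`_p = 0)%R.
    by rewrite additive_of_mulrn exp_primary.
  have z2 : ((z : additive_of hB2) *+ n`_p^' = 0)%R.
    have : (psi y : additive_of hB2) = 0%R by [].
    move=> /(congr1 (fun t => t *+ n`_p^')%R).
    rewrite GRing.mul0rn /psi (bigD1_seq p) ?primes_uniq //= GRing.mulrnDl.
    rewrite -[part p y]/(z : additive_of hB2) -GRing.sumrMnl big1_seq ?GRing.addr0 //.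
    move=> q /andP[qp q_n]; have [_ psi_q] := psiHP q q_n.
    have q_pr : prime q by move: q_n; rewrite mem_primes => /andP[].
    have := exp_primary q B2 hB2 _ q_pr B2n (psi_q _ (primary_part q B1 y B1n)).
    rewrite -(additive_of_mulrn (hB := hB2)) -/(part q y) => pq.
    have /dvdnP[c ->] : (n`_q %| n`_p^')%N.
      by apply: sub_in_partn => c _; rewrite !inE => /eqP ->.
    by rewrite mulnC GRing.mulrnA pq GRing.mul0rn.
  have := mulrn_gcd z1 z2.
  by rewrite (eqP (coprime_partC _ _ _)) GRing.mulr1n.
have [k] : exists k, (0 < k)%N && (y ^+ k == 1).
  by exists n; rewrite n_gt0 B1n eqxx.
move=> /(ex_intro (fun k => (0 < k)%N && (y ^+ k == 1)) k) /ex_minnP[{}k].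
move=> /andP[k_gt0 /eqP yk] kmin.
have k_dvd c : y ^+ c = 1 -> (k %| c)%N.
  move=> yc; have := @mulrn_gcd _ (y : additive_of hB1) k c.
  rewrite !additive_of_mulrn yk yc => /(_ erefl erefl) yg.
  have := kmin (gcdn k c); rewrite gcdn_gt0 k_gt0 -[_ ^+ _]/(y ^+ gcdn k c) yg eqxx.
  by move=> /(_ isT) kg; have := dvdn_leq k_gt0 (dvdn_gcdl k c) => gk;
    rewrite -(_ : gcdn k c = k) ?dvdn_gcdr //; apply/eqP; rewrite eqn_leq gk.
have [k1|k_gt1] := leqP k 1.
  have kE : k = 1%N by apply/eqP; rewrite eqn_leq k1.
  by move: yk; rewrite kE.
have p_pr := pdiv_prime k_gt1; have p_k := pdiv_dvd k.
have p_n : pdiv k \in primes n.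
  by rewrite mem_primes p_pr n_gt0 (dvdn_trans p_k (k_dvd _ (B1n y))).
have := dvdn_trans p_k (k_dvd _ (y_part _ p_n)).
by have := part_pnat (pdiv k)^' n; rewrite p'natE // => /negPf ->.
Qed.

(** Otherwise [n / p] would annihilate the group. *)
Lemma basis_top (B : groupType) (hB : abelian_group B) n p
    (X : set (additive_of hB)) :
  has_exponent B n -> prime p -> (p %| n)%N -> basis_of p X ->
  exists2 x, X x & (logn p n <= exponent_of p x)%N.
Proof.
move=> [n_gt0 Bn nmin] p_pr p_n [XP _ Xgen]; apply: contrapT => notop.
have Zn (z : additive_of hB) : (z *+ n = 0)%R by rewrite additive_of_mulrn Bn.
have u_gt0 : (0 < logn p n)%N by rewrite logn_gt0 mem_primes p_pr n_gt0.
have lt_top x : X x -> (exponent_of p x <= (logn p n).-1)%N.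
  move=> Xx; rewrite -ltnS prednK // ltnNge; apply/negP => ux.
  by apply: notop; exists x.
have nE : (n %/ p = n`_p^' * p ^ (logn p n).-1)%N.
  rewrite -{1}(partnC p n_gt0) p_part -{1}(prednK u_gt0) expnS -mulnA mulKn.
    by rewrite mulnC.
  exact: prime_gt0.
suff /nmin : forall y : B, y ^+ (n %/ p) = 1.
  rewrite divn_gt0 ?prime_gt0 // (dvdn_leq n_gt0 p_n) => /(_ isT).
  by rewrite leqNgt ltn_Pdiv // prime_gt1.
move=> y; rewrite -(additive_of_mulrn (y : additive_of hB)) nE GRing.mulrnA.
have [|l lX ->] := Xgen ((y : additive_of hB) *+ n`_p^')%R.
  by exists (logn p n); rewrite -GRing.mulrnA -p_part mulnC partnC.
rewrite -GRing.sumrMnl; apply: (@big1_seq (additive_of hB)) => x /andP[_ /lX Xx].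
by apply/(exponent_of_dvd p_pr _ (XP x Xx))/dvdn_exp2l/lt_top.
Qed.

Section BasisInvariants.
Variables (B1 B2 : groupType) (hB1 : abelian_group B1) (hB2 : abelian_group B2).
Variables (n p : nat) (X1 : set (additive_of hB1)) (X2 : set (additive_of hB2)).
Hypotheses (n_gt0 : (0 < n)%N) (p_pr : prime p).
Hypotheses (B1n : forall x : B1, x ^+ n = 1) (B2n : forall x : B2, x ^+ n = 1).
Hypotheses (bX1 : basis_of p X1) (bX2 : basis_of p X2).

Let Z1n (x : additive_of hB1) : (x *+ n = 0)%R.
Proof. by rewrite additive_of_mulrn B1n. Qed.
Let Z2n (x : additive_of hB2) : (x *+ n = 0)%R.
Proof. by rewrite additive_of_mulrn B2n. Qed.

Lemma isog_of_levels : (forall e, level p X1 e #= level p X2 e) ->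
  set_isog (primary B1 p) (primary B2 p).
Proof.
move=> card12.
have [phi phiP] := all_sig (fun e => cid (card_eq_bij (0%R : additive_of hB2) (card12 e))).
pose rho x := phi (exponent_of p x) x.
have rhoP x : X1 x -> X2 (rho x) /\ exponent_of p (rho x) = exponent_of p x.
  by move=> Xx; have [homo _ _] := phiP (exponent_of p x); apply: (homo x).
have rho_inj x y : X1 x -> X1 y -> rho x = rho y -> x = y.
  move=> Xx Xy rxy; have [_ ex] := rhoP x Xx; have [_ ey] := rhoP y Xy.
  have exy : exponent_of p x = exponent_of p y by rewrite -ex rxy ey.
  have [_ inj _] := phiP (exponent_of p x).
  by apply: inj; rewrite ?inE //; move: rxy; rewrite /rho exy.
have rho_surj z : X2 z -> exists2 x, X1 x & rho x = z.
  move=> Xz; have [_ _ surj] := phiP (exponent_of p z).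
  have [//|x [Xx ex] xz] := surj z.
  by exists x => //; rewrite /rho ex.
pose c (k : X1) : additive_of hB2 := rho (\val k).
have c_inj : injective c.
  by move=> k k' /rho_inj kk'; apply/val_inj/kk'; apply: set_valP.
have Xc k : X2 (c k) by have [] := rhoP _ (set_valP k).
apply: (@gen_isog B1 B2 hB1 hB2 n X1 (fun k => \val k) c) => //.
- exact: (basis_elements_span n_gt0 B1n p_pr bX1).
- move=> y; have := basis_elements_span n_gt0 B2n p_pr bX2 y; move=> [yP1 yP2].
  split=> [/yP1[l ->]|[l ->]].
    elim: l => [|k l [l' l'E]]; first by exists [::]; rewrite !big_nil.
    have [x Xx xk] := rho_surj _ (set_valP k).
    have xX : x \in X1 by rewrite inE.
    by exists ((exist _ x xX : X1) :: l'); rewrite !big_cons l'E /c /= xk.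
  have /(basis_elements_span n_gt0 B2n p_pr bX2) // : exists l' : seq X2,
      (\sum_(k <- l) c k = \sum_(k <- l') \val k)%R.
  elim: l => [|k l [l' l'E]]; first by exists [::]; rewrite !big_nil.
  have kX : c k \in X2 by rewrite inE.
  by exists ((exist _ (c k) kX : X2) :: l'); rewrite !big_cons l'E.
move=> l; rewrite (basis_relation p_pr l bX1 val_inj) => [|k]; last exact: set_valP.
rewrite (basis_relation p_pr l bX2 c_inj) //.
by split=> dvd_l k; have := dvd_l k; rewrite (rhoP _ (set_valP k)).2.
Qed.

Lemma finite_primary : (forall e, finite_set (level p X1 e)) ->
  finite_set (primary B1 p).
Proof.
move=> fin; have [XP _ Xgen] := bX1.
have X1fin : finite_set X1.
  apply: (@sub_finite_set _ _ (\bigcup_(e in `I_(logn p n).+1) level p X1 e)).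
    move=> x Xx; exists (exponent_of p x) => //=.
    by rewrite ltnS; apply: (exponent_of_le n_gt0 Z1n p_pr); apply: XP.
  by apply: bigcup_finite => //; apply: finite_II.
apply: sub_finite_set (finite_nspan n_gt0 Z1n X1fin) => y [k yk].
by apply: Xgen; exists k; rewrite additive_of_mulrn.
Qed.

Lemma infinite_primary e : infinite_set (level p X1 e) ->
  infinite_set (primary B1 p).
Proof.
move=> inf; apply: (sub_infinite_set _ inf) => x [Xx _].
have [XP _ _] := bX1; have [k xk] := XP x Xx.
by exists k; rewrite -(additive_of_mulrn x).
Qed.

Lemma level_list_split (X : set (additive_of hB1)) e : basis_of p X ->
  level p X e !=set0 -> exists t, level_list n p X =
    [seq f <- rev (iota e.+1 (logn p n - e)) | `[< level p X f !=set0 >]] ++ e :: t.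
Proof.
move=> [XP X0 Xgen] Xe; have [x [Xx ex]] := Xe.
have e_gt0 : (0 < e)%N.
  by rewrite -ex; apply: exponent_of_gt0 (XP x Xx) _ => // x0; case: X0 => + _; rewrite -x0.
have eu : (e <= logn p n)%N.
  by rewrite -ex; apply: (exponent_of_le n_gt0 Z1n p_pr); apply: XP.
exists [seq f <- rev (iota 1 e.-1) | `[< level p X f !=set0 >]].
have uE : logn p n = (e.-1 + (logn p n - e).+1)%N.
  by rewrite addnS -addSn prednK // subnKC.
rewrite /level_list {1}uE iotaD rev_cat filter_cat add1n prednK //= rev_cons.
by rewrite filter_rcons asboolT // cat_rcons.
Qed.

End BasisInvariants.

Lemma card_eq_nonempty (T U : Type) (A : set T) (B : set U) :
  A #= B -> A !=set0 -> B !=set0.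
Proof.
move=> AB [x Ax]; apply/set0P/negP => /eqP B0.
by move: AB; rewrite B0 card_eq0 => /eqP A0; rewrite A0 in Ax.
Qed.

(** * The equivalence read off from bases *)

Section EquivalenceOfLevels.
Variables (B1 B2 : groupType) (hB1 : abelian_group B1) (hB2 : abelian_group B2).
Variables (n p : nat) (X1 : set (additive_of hB1)) (X2 : set (additive_of hB2)).
Hypotheses (n_gt0 : (0 < n)%N) (p_pr : prime p).
Hypotheses (B1n : forall x : B1, x ^+ n = 1) (B2n : forall x : B2, x ^+ n = 1).
Hypotheses (bX1 : basis_of p X1) (bX2 : basis_of p X2).

Lemma primary_equiv_finite :
  (forall e, finite_set (level p X1 e) /\ level p X1 e #= level p X2 e) ->
  primary_equiv p B1 B2.
Proof.
move=> fin12; left; split.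
- by apply: (finite_primary n_gt0 p_pr B1n bX1) => e; have [] := fin12 e.
- apply: (finite_primary n_gt0 p_pr B2n bX2) => e; have [fin /eq_finite_set E] := fin12 e.
  by rewrite -E.
- by apply: (isog_of_levels n_gt0 p_pr B1n B2n bX1 bX2) => e; have [] := fin12 e.
Qed.

Lemma primary_equiv_infinite e :
  infinite_set (level p X1 e) -> infinite_set (level p X2 e) ->
  (forall f, (e < f)%N ->
     finite_set (level p X1 f) /\ level p X1 f #= level p X2 f) ->
  primary_equiv p B1 B2.
Proof.
move=> inf1 inf2 above; right; split.
- exact: (infinite_primary bX1 inf1).
- exact: (infinite_primary bX2 inf2).
have [t1 E1] := level_list_split n_gt0 p_pr B1n bX1 (infinite_setN0 inf1).
have [t2 E2] := level_list_split n_gt0 p_pr B2n bX2 (infinite_setN0 inf2).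
set pre := filter _ _ in E1.
have preE : [seq f <- rev (iota e.+1 (logn p n - e)) | `[< level p X2 f !=set0 >]] = pre.
  apply: eq_in_filter => f; rewrite mem_rev mem_iota => /andP[ef _].
  have [_ card12] := above f ef.
  apply/asboolP/asboolP; apply: card_eq_nonempty => //; exact: card_esym.
rewrite {}preE in E2.
have nth_lt t i : (i < size pre)%N -> nth 0%N (pre ++ e :: t) i = nth 0%N pre i.
  by move=> ik; rewrite nth_cat ik.
have nth_k t : nth 0%N (pre ++ e :: t) (size pre) = e by rewrite nth_cat ltnn subnn.
have pre_gt i : (i < size pre)%N -> (e < nth 0%N pre i)%N.
  move=> ik; have := mem_nth 0%N ik.
  by rewrite mem_filter mem_rev mem_iota => /and3P[].
have e_gt0 : (0 < e)%N.
  rewrite lt0n; apply/eqP => e0; apply: inf1; rewrite e0 (level0 bX1).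
  exact: finite_set0.
exists (size (level_list n p X1)), (size (level_list n p X2)).
exists (nth 0%N (level_list n p X1)), (nth 0%N (level_list n p X2)).
exists (fun i => level p X1 (nth 0%N (level_list n p X1) i) : Type).
exists (fun i => level p X2 (nth 0%N (level_list n p X2) i) : Type).
split; first exact: (basis_decomposition n_gt0 B1n p_pr bX1).
  exact: (basis_decomposition n_gt0 B2n p_pr bX2).
have infT (T : Type) (A : set T) : infinite_set A -> infinite_set [set: A].
  by rewrite (eq_finite_set (card_setT A)).
have finT (T : Type) (A : set T) : finite_set A -> finite_set [set: A].
  by rewrite (eq_finite_set (card_setT A)).
exists (size pre); rewrite E1 E2; split.
- by rewrite !size_cat /= !addnS !ltnS !leq_addr.
- move=> i ik; rewrite !nth_lt //; split=> //.
  have [_ card12] := above _ (pre_gt i ik).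
  by rewrite (card_eql (card_setT _)) (card_eqr (card_setT _)).
- split=> [|i ik].
    by apply: infinite_cyclic_pow; [rewrite nth_k -(expn0 p) ltn_exp2l ?prime_gt1|rewrite nth_k; apply: infT].
  by apply: finite_cyclic_pow; rewrite nth_lt //; apply: finT; have [] := above _ (pre_gt i ik).
- split=> [|i ik].
    by apply: infinite_cyclic_pow; [rewrite nth_k -(expn0 p) ltn_exp2l ?prime_gt1|rewrite nth_k; apply: infT].
  apply: finite_cyclic_pow; rewrite nth_lt //; apply: finT.
  by have [fin /eq_finite_set <-] := above _ (pre_gt i ik).
- by rewrite !nth_k.
Qed.

End EquivalenceOfLevels.

Lemma primary_equiv_sym p (B1 B2 : groupType) :
  abelian_group B1 -> abelian_group B2 ->
  primary_equiv p B1 B2 -> primary_equiv p B2 B1.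
Proof.
move=> hB1 hB2 [[fin1 fin2 [f [[f_homo f_inj f_surj] fM]]]|].
  left; split=> //.
  have P1M := subgroupM (primary_subgroup p hB1).
  have P2M := subgroupM (primary_subgroup p hB2).
  have [|g gP] := @choice B2 B1 (fun y x => primary B2 p y ->
      primary B1 p x /\ f x = y).
    move=> y; have [/f_surj[x Px xy]|] := EM (primary B2 p y); last by exists 1.
    by exists x.
  exists g; split; [split|].
  - by move=> y /gP[].
  - move=> y y' /set_mem Py /set_mem Py' gyy'.
    by rewrite -(gP y Py).2 gyy' (gP y' Py').2.
  - move=> x Px; have Pfx := f_homo x Px; exists (f x) => //.
    have [Pg fg] := gP _ Pfx.
    by apply: f_inj; rewrite ?inE.
  - move=> y y' Py Py'; have [Pg fg] := gP y Py; have [Pg' fg'] := gP y' Py'.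
    have [Pgg fgg] := gP _ (P2M _ _ Py Py').
    apply: f_inj; rewrite ?inE //; first exact: P1M.
    by rewrite fgg fM // fg fg'.
move=> [inf1 inf2 [r [s [u [v [M [N [pd1 pd2 [k [[kr ks] below fi1 fi2 ukv]]]]]]]]]].
right; split=> //; exists s, r, v, u, N, M; split=> //; exists k; split=> // i ik.
by have [-> /card_esym] := below i ik.
Qed.

Theorem theorem2p3 (m n : nat) (A1 A2 B1 B2 : groupType)
  (m_gt0 : 0 < m) (n_gt0 : 0 < n)
  (A1_nontriv : nontrivial A1) (A2_nontriv : nontrivial A2)
  (A1_nil : nilpotent_group A1) (A2_nil : nilpotent_group A2)
  (A1_exp : has_exponent A1 m) (A2_exp : has_exponent A2 m)
  (A12_var : same_var A1 A2)
  (B1_nontriv : nontrivial B1) (B2_nontriv : nontrivial B2)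
  (B1_abel : abelian_group B1) (B2_abel : abelian_group B2)
  (B1_exp : has_exponent B1 n) (B2_exp : has_exponent B2 n)
  (B12_var : same_var B1 B2)
  (prime_div : forall p : nat, prime p -> p %| n -> p %| m) :
  same_var (wreath A1 B1) (wreath A2 B2) <->
  (forall p : nat, prime p -> p %| n -> primary_equiv p B1 B2).
Proof.
have [_ B1n _] := B1_exp; have [_ B2n _] := B2_exp.
have A12 w : satisfies A1 w <-> satisfies A2 w by have /same_varP := A12_var; apply.
split=> [/same_varP same p p_pr p_n|equiv]; last first.
  apply/same_varP => w; split; apply: wreath_satisfies => //.
  - by move=> w' /A12.
  - apply: (local_embedding B2_abel B1_abel n_gt0 B2n B1n) => p p_pr p_n.
    exact/primary_equiv_sym/equiv.
  - by move=> w' /A12.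
  - exact: (local_embedding B1_abel B2_abel n_gt0 B1n B2n).
have p_m := prime_div p p_pr p_n.
have Z1n (z : additive_of B1_abel) : (z *+ n = 0)%R by rewrite additive_of_mulrn B1n.
have Z2n (z : additive_of B2_abel) : (z *+ n = 0)%R by rewrite additive_of_mulrn B2n.
have [X1 bX1] := exists_basis n_gt0 Z1n p_pr.
have [X2 bX2] := exists_basis n_gt0 Z2n p_pr.
(* the passive groups may be assumed to be equal *)
have swap (B C D : groupType) w : (forall w, satisfies C w -> satisfies B w) ->
    satisfies (wreath C D) w -> satisfies (wreath B D) w.
  by move=> CB; apply: wreath_satisfies => // N b _; exists b.
have laws12 w : satisfies (wreath A1 B1) w -> satisfies (wreath A1 B2) w.
  by move=> /same; apply: swap => w' /A12.
have laws21 w : satisfies (wreath A1 B2) w -> satisfies (wreath A1 B1) w.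
  by move=> lw; apply/same; apply: swap lw => w' /A12.
pose agree e f := (e <= f)%N ->
  finite_set (level p X1 f) /\ level p X1 f #= level p X2 f.
have ex_e : exists e, `[< (0 < e)%N /\ forall f, agree e f >].
  exists (logn p n).+1; apply/asboolP; split=> // f uf.
  rewrite (level_big n_gt0 Z1n p_pr bX1 uf) (level_big n_gt0 Z2n p_pr bX2 uf).
  by split; [apply: finite_set0|apply: card_eq00].
case: (ex_minnP ex_e) => -[|[|e]] /asboolP[//= _ agree_e] e_min.
  apply: (primary_equiv_finite n_gt0 p_pr B1n B2n bX1 bX2) => -[|f]; last exact: agree_e.
  rewrite (level0 bX1) (level0 bX2).
  by split; [apply: finite_set0|apply: card_eq00].
have disagree : ~ (finite_set (level p X1 e.+1) /\ level p X1 e.+1 #= level p X2 e.+1).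
  move=> agree_e1; have := e_min e.+1; rewrite ltnn => /(_ _)/negP; apply=> //.
  apply/asboolP; split=> // f; rewrite /agree leq_eqVlt => /predU1P[<- //|].
  exact: agree_e.
have e_top : (e.+1 <= logn p n)%N.
  rewrite -ltnS; apply: (e_min (logn p n).+1).
  apply/asboolP; split=> // f uf.
  rewrite (level_big n_gt0 Z1n p_pr bX1 uf) (level_big n_gt0 Z2n p_pr bX2 uf).
  by split; [apply: finite_set0|apply: card_eq00].
have top1 : exists2 x, X1 x & (e.+1 <= exponent_of p x)%N.
  have [x Xx ux] := basis_top B1_exp p_pr p_n bX1.
  by exists x => //; apply: leq_trans ux.
have top2 : exists2 x, X2 x & (e.+1 <= exponent_of p x)%N.
  have [x Xx ux] := basis_top B2_exp p_pr p_n bX2.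
  by exists x => //; apply: leq_trans ux.
have agree_e' f : (e.+1 < f)%N ->
    finite_set (level p X2 f) /\ level p X2 f #= level p X1 f.
  move=> /agree_e[fin card12]; split; last exact: card_esym.
  by rewrite -(eq_finite_set card12).
have le21 : finite_set (level p X1 e.+1) -> level p X2 e.+1 #<= level p X1 e.+1.
  exact: (level_card_le A1_nil A1_exp p_pr p_m n_gt0 Z1n Z2n laws12).
have le12 : finite_set (level p X2 e.+1) -> level p X1 e.+1 #<= level p X2 e.+1.
  exact: (level_card_le A1_nil A1_exp p_pr p_m n_gt0 Z2n Z1n laws21).
apply: (primary_equiv_infinite n_gt0 p_pr B1n B2n bX1 bX2 _ _ agree_e) => fin.
  apply: disagree; split=> //; apply: Cantor_Bernstein; last exact: le21.
  by apply: le12; apply: card_le_finite (le21 fin) fin.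
have fin1 := card_le_finite (le12 fin) fin.
by apply: disagree; split=> //; apply: Cantor_Bernstein; [apply: le12|apply: le21].
Qed.
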